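(* Let $n\ge 2$. The subspace $\mathcal J_n=\bigcup_{(G,g)}J(G,g)$ of Outer space $\mathcal O_n$ is a closed subspace of $\mathcal O_n$, and it is an $\mathrm{Out}(F_n)$-equivariant deformation retract of $\mathcal O_n$ on which $\mathrm{Out}(F_n)$ acts cocompactly.
   Context: **Outer space.** Let $n\ge2$, $F_n$ the free group of rank $n$, and $R_n$ a rose with $n$ petals, with $\pi_1(R_n)$ identified with $F_n$. A marked graph $(G,g)$ consists of a finite connected metric graph $G$ with no univalent or bivalent vertices and no separating edges, with positive edge lengths summing to $1$, together with a homotopy equivalence $g:R_n\to G$ (the marking). Two marked graphs are identified if there is an isometry between them commuting with the markings up to homotopy. $\mathcal O_n$ is the set of equivalence classes (this is often called reduced Outer space). Fixing the combinatorial type of $(G,g)$ and varying the positive edge lengths with sum $1$ gives an open simplex $\mathring\sigma(G,g)$ (of dimension one less than the number of edges), and $\mathcal O_n$ is the disjoint union of these. $\mathring\sigma(G',g')$ is a face of $\mathring\sigma(G,g)$ when $(G',g')$ is obtained from $(G,g)$ by collapsing each component of a forest of $G$ to a point; $\mathcal O_n$ is topologized by gluing the simplices-with-missing-faces $\bar\sigma(G,g)$ (the union of $\mathring\sigma(G,g)$ and all such faces) along these face relations. $\mathrm{Out}(F_n)$ acts by changing the marking. **Jewels.** A subgraph of $G$ is the closure of a set of edges. A subgraph $H$ is core if no edge $e$ of $H$ separates $H$, i.e. removing the open edge $e$ never increases the number of components of $H$; core subgraphs may be disconnected. If $G$ has edges $e_0,\dots,e_m$, let $\sigma(G)=\{(x_0,\dots,x_m)\in\mathbb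 R^{m+1}: x_i\ge0,\ \sum x_i=1\}$; $\bar\sigma(G,g)$ is the subset of $\sigma(G)$ obtained by removing those faces in which the edges of coordinate $0$ contain a loop. Fix constants $0<c_1<c_2<\dots<c_n\ll1$ (sufficiently small depending on $n$) with $c_{r+1}>2c_r$, and for a nonempty core subgraph $A$ put $c_A=c_r$, $r=\operatorname{rank}H_1(A)$. The jewel is $$J(G)=\Big\{x\in\sigma(G): \sum_{e_i\in A}x_i\ge c_A\ \text{for all nonempty core subgraphs }A\subseteq G\Big\},$$ and $J(G,g)\subset\bar\sigma(G,g)\subset\mathcal O_n$ denotes the corresponding set for the marked graph $(G,g)$. *)

(* Defs.v *)
From HB Require Import structures.
From mathcomp Require Import all_boot all_order all_algebra.
From mathcomp Require Import generic_quotient.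
From mathcomp Require Import all_classical all_reals all_analysis.

Set Implicit Arguments.
Unset Strict Implicit.
Unset Printing Implicit Defensive.

Import Order.TTheory GRing.Theory Num.Theory.
Import numFieldNormedType.Exports.

Local Open Scope quotient_scope.

(** * Finite graphs *)

(* Loops and multiple edges are allowed.  The orientation of the edges given by
   [src] and [tgt] is arbitrary: maps and isometries may reverse edges.  Every
   finite graph is isomorphic to one of this form. *)
Record graph := Graph {
  nvert : nat;
  nedge : nat;
  src : 'I_nedge -> 'I_nvert;
  tgt : 'I_nedge -> 'I_nvert }.

Definition vert (G : graph) := 'I_(nvert G).
Definition edge (G : graph) := 'I_(nedge G).

(* An oriented edge: [(e, true)] runs from [src e] to [tgt e], [(e, false)]
   runs backwards. *)
Definition dart (G : graph) : Type := ('I_(nedge G) * bool)%type.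
Definition dsrc (G : graph) (d : dart G) : vert G :=
  if d.2 then src d.1 else tgt d.1.
Definition dtgt (G : graph) (d : dart G) : vert G :=
  if d.2 then tgt d.1 else src d.1.
Definition drev (G : graph) (d : dart G) : dart G := (d.1, ~~ d.2).

Fixpoint is_walk (G : graph) (u : vert G) (p : seq (dart G)) (v : vert G) :=
  if p is d :: p' then (dsrc d == u) && is_walk (dtgt d) p' v else u == v.

Definition wrev (G : graph) (p : seq (dart G)) : seq (dart G) :=
  rev [seq drev d | d <- p].

(* Homotopy of edge paths relative to their endpoints. *)
Inductive whtpy (G : graph) : seq (dart G) -> seq (dart G) -> Prop :=
| whtpy_cancel p d q : whtpy (p ++ d :: drev d :: q) (p ++ q)
| whtpy_refl p : whtpy p p
| whtpy_sym p q : whtpy p q -> whtpy q p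
| whtpy_trans q p r : whtpy p q -> whtpy q r -> whtpy p r.

(** ** Subgraphs *)

(* A subgraph, i.e. the closure of a set of edges, is given by its set of
   edges [A]; [sverts A] is its set of vertices. *)
Section Subgraphs.
Variable G : graph.
Implicit Types (A : {set edge G}) (e : edge G) (u v : vert G).

Definition sverts A : {set vert G} :=
  [set v | [exists e in A, (src e == v) || (tgt e == v)]].

Definition adj A : rel (vert G) := fun u v =>
  [exists e in A, ((src e == u) && (tgt e == v)) ||
                  ((src e == v) && (tgt e == u))].

(* Only the open edge [e] is removed: its endpoints remain. *)
Definition separates A e : bool :=
  n_comp (adj A) (mem (sverts A)) < n_comp (adj (A :\ e)) (mem (sverts A)).

Definition core A : bool := [forall e in A, ~~ separates A e].

Definition boundary A : 'M[rat]_(#|A|, nvert G) :=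
  (\matrix_(i, v) ((tgt (enum_val i) == v)%:R - (src (enum_val i) == v)%:R))%R.

(* The rank of the free abelian group H_1(A) = ker (boundary). *)
Definition rankH1 A : nat := \rank (kermx (boundary A)).

Definition is_loop (p : seq (dart G)) : Prop :=
  [/\ p != [::], exists v, is_walk v p v,
      uniq [seq d.1 | d <- p] & uniq [seq dsrc d | d <- p]].

Definition contains_loop A : Prop :=
  exists p : seq (dart G), is_loop p /\ forall d, d \in p -> d.1 \in A.

Definition valence v : nat := #|[set d : dart G | dsrc d == v]|.

End Subgraphs.

Definition outer_graph (G : graph) : Prop :=
  [/\ forall u v : vert G, connect (adj [set: edge G]) u v,
      forall v : vert G, valence v != 1 /\ valence v != 2 &
      forall e : edge G, ~~ separates [set: edge G] e].

(** ** Maps of graphs and homotopies *)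

(* A cellular map, sending vertices to vertices and edges to edge paths.  Every
   continuous map between finite graphs is homotopic to one of this form, and
   homotopies between such maps can be taken as in [homotopic] below. *)
Record gmap (G H : graph) := GMap {
  gv : vert G -> vert H;
  ge : edge G -> seq (dart H);
  geP : forall e, is_walk (gv (src e)) (ge e) (gv (tgt e)) }.

Definition gd (G H : graph) (f : gmap G H) (d : dart G) : seq (dart H) :=
  if d.2 then ge f d.1 else wrev (ge f d.1).
Definition gw (G H : graph) (f : gmap G H) (p : seq (dart G)) : seq (dart H) :=
  flatten [seq gd f d | d <- p].

(* A homotopy from [f] to [f'], up to homotopy: the track [p v] of each vertex
   [v] is an edge path, and each edge sweeps out a square which commutes up to
   homotopy relative to the endpoints. *)
Definition homotopic (G H : graph) (f f' : gmap G H) : Prop :=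
  exists p : vert G -> seq (dart H),
    (forall v, is_walk (gv f v) (p v) (gv f' v)) /\
    (forall e, whtpy (ge f e ++ p (tgt e)) (p (src e) ++ ge f' e)).

Section Walks.
Variable G : graph.
Implicit Types (p q r : seq (dart G)) (u v w : vert G).

Lemma drevK : involutive (@drev G).
Proof. by case=> e b; rewrite /drev /= negbK. Qed.

Lemma dsrc_drev (d : dart G) : dsrc (drev d) = dtgt d.
Proof. by case: d => e []. Qed.

Lemma dtgt_drev (d : dart G) : dtgt (drev d) = dsrc d.
Proof. by case: d => e []. Qed.

Lemma wrevK : involutive (@wrev G).
Proof.
by move=> p; rewrite /wrev map_rev revK -map_comp map_id_in // => d _; exact: drevK.
Qed.

Lemma wrev_cat p q : wrev (p ++ q) = wrev q ++ wrev p.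
Proof. by rewrite /wrev map_cat rev_cat. Qed.

Lemma wrev_cons d p : wrev (d :: p) = wrev p ++ [:: drev d].
Proof. by rewrite -cat1s wrev_cat. Qed.

Lemma is_walk_cat u v w p q :
  is_walk u p v -> is_walk v q w -> is_walk u (p ++ q) w.
Proof.
elim: p u => [|d p IH] u /=; first by move/eqP->.
by case/andP=> -> /= /IH; apply.
Qed.

Lemma is_walk_wrev u v p : is_walk u p v -> is_walk v (wrev p) u.
Proof.
elim: p u => [|d p IH] u /=; first by move/eqP->; rewrite /wrev /=.
case/andP=> /eqP <- /IH wp; rewrite wrev_cons; apply: is_walk_cat wp _.
by rewrite /= dsrc_drev dtgt_drev !eqxx.
Qed.

Lemma whtpy_catl r p q : whtpy p q -> whtpy (r ++ p) (r ++ q).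
Proof.
elim=> {p q} [p d q|p|p q _ IH|q p s _ IH1 _ IH2].
- by rewrite !catA -[_ ++ q]catA; have := whtpy_cancel (r ++ p) d q; rewrite -!catA.
- exact: whtpy_refl.
- exact: whtpy_sym.
- exact: whtpy_trans IH1 IH2.
Qed.

Lemma whtpy_catr r p q : whtpy p q -> whtpy (p ++ r) (q ++ r).
Proof.
elim=> {p q} [p d q|p|p q _ IH|q p s _ IH1 _ IH2].
- by rewrite -!catA /=; exact: whtpy_cancel.
- exact: whtpy_refl.
- exact: whtpy_sym.
- exact: whtpy_trans IH1 IH2.
Qed.

Lemma whtpy_cat p p' q q' :
  whtpy p p' -> whtpy q q' -> whtpy (p ++ q) (p' ++ q').
Proof. by move=> pp' qq'; apply: whtpy_trans (whtpy_catr q pp') (whtpy_catl p' qq'). Qed.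

Lemma whtpy_wrev p q : whtpy p q -> whtpy (wrev p) (wrev q).
Proof.
elim=> {p q} [p d q|p|p q _ IH|q p s _ IH1 _ IH2].
- rewrite !wrev_cat !wrev_cons -!catA /=; rewrite drevK.
  by have := whtpy_cancel (wrev q) d (wrev p).
- exact: whtpy_refl.
- exact: whtpy_sym.
- exact: whtpy_trans IH1 IH2.
Qed.

Lemma whtpy_wrevr p : whtpy (p ++ wrev p) [::].
Proof.
elim: p => [|d p IH]; first exact: whtpy_refl.
rewrite wrev_cons -cat1s -catA (catA p).
apply: whtpy_trans (whtpy_catl _ (whtpy_catr _ IH)) _.
exact: (whtpy_cancel [::] d [::]).
Qed.

Lemma whtpy_wrevl p : whtpy (wrev p ++ p) [::].
Proof. by have := whtpy_wrevr (wrev p); rewrite wrevK. Qed.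

End Walks.

Section GMapTheory.

Lemma gd_drev (G H : graph) (f : gmap G H) d : gd f (drev d) = wrev (gd f d).
Proof. by case: d => e []; rewrite /gd //= wrevK. Qed.

Lemma gw_cat (G H : graph) (f : gmap G H) p q : gw f (p ++ q) = gw f p ++ gw f q.
Proof. by rewrite /gw map_cat flatten_cat. Qed.

Lemma gw_cons (G H : graph) (f : gmap G H) d p : gw f (d :: p) = gd f d ++ gw f p.
Proof. by []. Qed.

Lemma gw1 (G H : graph) (f : gmap G H) d : gw f [:: d] = gd f d.
Proof. by rewrite gw_cons cats0. Qed.

Lemma gw_wrev (G H : graph) (f : gmap G H) p : gw f (wrev p) = wrev (gw f p).
Proof.
elim: p => // d p IH.
by rewrite wrev_cons gw_cat IH gw1 gd_drev gw_cons wrev_cat.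
Qed.

Lemma gd_walk (G H : graph) (f : gmap G H) d :
  is_walk (gv f (dsrc d)) (gd f d) (gv f (dtgt d)).
Proof. by case: d => e []; [exact: geP | apply: is_walk_wrev; exact: geP]. Qed.

Lemma gw_walk (G H : graph) (f : gmap G H) u p v :
  is_walk u p v -> is_walk (gv f u) (gw f p) (gv f v).
Proof.
elim: p u => [|d p IH] u /=; first by move/eqP->.
by case/andP=> /eqP <- /IH wp; rewrite gw_cons; apply: is_walk_cat wp; exact: gd_walk.
Qed.

Lemma gw_whtpy (G H : graph) (f : gmap G H) p q :
  whtpy p q -> whtpy (gw f p) (gw f q).
Proof.
elim=> {p q} [p d q|p|p q _ IH|q p s _ IH1 _ IH2].
- rewrite !gw_cat !gw_cons gd_drev; apply: whtpy_catl.
  by rewrite catA; apply: (whtpy_catr _ (whtpy_wrevr _)).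
- exact: whtpy_refl.
- exact: whtpy_sym.
- exact: whtpy_trans IH1 IH2.
Qed.

End GMapTheory.

Lemma whtpy_eq (G : graph) (p q : seq (dart G)) : p = q -> whtpy p q.
Proof. by move->; exact: whtpy_refl. Qed.

Section Homotopy.

Lemma gid_walk (G : graph) (e : edge G) : is_walk (src e) [:: (e, true)] (tgt e).
Proof. by rewrite /= !eqxx. Qed.

Definition gid (G : graph) : gmap G G := GMap (gv := id) (@gid_walk G).

Lemma gcomp_walk (G H K : graph) (h : gmap H K) (f : gmap G H) (e : edge G) :
  is_walk (gv h (gv f (src e))) (gw h (ge f e)) (gv h (gv f (tgt e))).
Proof. exact/gw_walk/geP. Qed.

Definition gcomp (G H K : graph) (h : gmap H K) (f : gmap G H) : gmap G K :=
  GMap (gv := gv h \o gv f) (gcomp_walk h f).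

Lemma gw_gid (G : graph) (p : seq (dart G)) : gw (gid G) p = p.
Proof. by elim: p => // -[e []] p IH; rewrite gw_cons IH. Qed.

Lemma gd_gcomp (G H K : graph) (h : gmap H K) (f : gmap G H) d :
  gd (gcomp h f) d = gw h (gd f d).
Proof. by case: d => e []; rewrite /gd //= gw_wrev. Qed.

Lemma gw_gcomp (G H K : graph) (h : gmap H K) (f : gmap G H) p :
  gw (gcomp h f) p = gw h (gw f p).
Proof. by elim: p => // d p IH; rewrite !gw_cons gw_cat IH gd_gcomp. Qed.

Lemma homotopic_eqv (G H : graph) (f f' : gmap G H) :
  gv f =1 gv f' -> (forall e, whtpy (ge f e) (ge f' e)) -> homotopic f f'.
Proof.
move=> fv fe; exists (fun=> [::]); split=> [v|e] /=; first by rewrite fv.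
by rewrite cats0.
Qed.

Lemma homotopic_eq (G H : graph) (f f' : gmap G H) :
  gv f =1 gv f' -> ge f =1 ge f' -> homotopic f f'.
Proof. by move=> fv fe; apply: homotopic_eqv => // e; apply: whtpy_eq. Qed.

Lemma homotopic_refl (G H : graph) (f : gmap G H) : homotopic f f.
Proof. exact: homotopic_eq. Qed.

Lemma homotopic_sym (G H : graph) (f f' : gmap G H) :
  homotopic f f' -> homotopic f' f.
Proof.
move=> [p [wp hp]]; exists (fun v => wrev (p v)); split=> [v|e].
  exact: is_walk_wrev.
set a := ge f e; set a' := ge f' e; set q := p (src e); set r := p (tgt e).
have h1 : whtpy (a' ++ wrev r) (wrev q ++ q ++ a' ++ wrev r).
  by rewrite catA; apply: whtpy_sym; exact: (whtpy_catr _ (whtpy_wrevl q)).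
apply: whtpy_trans h1 _; apply: whtpy_catl.
rewrite catA; apply: whtpy_trans (whtpy_catr _ (whtpy_sym (hp e))) _.
rewrite -catA -[X in whtpy _ X]cats0; apply: whtpy_catl; exact: whtpy_wrevr.
Qed.

Lemma homotopic_trans (G H : graph) (f2 f1 f3 : gmap G H) :
  homotopic f1 f2 -> homotopic f2 f3 -> homotopic f1 f3.
Proof.
move=> [p [wp hp]] [q [wq hq]]; exists (fun v => p v ++ q v); split=> [v|e].
  exact: is_walk_cat (wp v) (wq v).
rewrite catA; apply: whtpy_trans (whtpy_catr _ (hp e)) _.
by rewrite -!catA; apply: whtpy_catl; exact: hq.
Qed.

Lemma homotopic_walk (G H : graph) (f f' : gmap G H) p :
  (forall e, whtpy (ge f e ++ p (tgt e)) (p (src e) ++ ge f' e)) ->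
  forall u w v, is_walk u w v -> whtpy (gw f w ++ p v) (p u ++ gw f' w).
Proof.
move=> hp.
have hd d : whtpy (gd f d ++ p (dtgt d)) (p (dsrc d) ++ gd f' d).
  case: d => e [] /=; rewrite /gd /dsrc /dtgt /=; first exact: hp.
  set a := ge f e; set a' := ge f' e; set q := p (src e); set r := p (tgt e).
  have h1 : whtpy (wrev a ++ q) (wrev a ++ (q ++ a') ++ wrev a').
    apply: whtpy_catl; rewrite -catA -[X in whtpy X _]cats0; apply: whtpy_catl.
    exact/whtpy_sym/whtpy_wrevr.
  apply: whtpy_trans h1 _.
  apply: whtpy_trans (whtpy_catl _ (whtpy_catr _ (whtpy_sym (hp e)))) _.
  by rewrite -/a -catA catA; exact: (whtpy_catr _ (whtpy_wrevl a)).
move=> u w v; elim: w u => [|d w IH] u /=.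
  by move=> /eqP ->; rewrite cats0; exact: whtpy_refl.
case/andP=> /eqP <- /IH hw; rewrite !gw_cons -catA.
apply: whtpy_trans (whtpy_catl _ hw) _.
by rewrite !catA; apply: whtpy_catr.
Qed.

Lemma homotopic_compr (G H K : graph) (h : gmap G H) (f f' : gmap H K) :
  homotopic f f' -> homotopic (gcomp f h) (gcomp f' h).
Proof.
move=> [p [wp hp]]; exists (fun v => p (gv h v)); split=> [v|e]; first exact: wp.
exact: (homotopic_walk hp) (geP h e).
Qed.

Lemma homotopic_compl (G H K : graph) (h : gmap H K) (f f' : gmap G H) :
  homotopic f f' -> homotopic (gcomp h f) (gcomp h f').
Proof.
move=> [p [wp hp]]; exists (fun v => gw h (p v)); split=> [v|e].
  by apply: (gw_walk h); exact: wp.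
by rewrite /= -!gw_cat; apply: gw_whtpy; exact: hp.
Qed.

Lemma gcompA (G H K L : graph) (k : gmap K L) (h : gmap H K) (f : gmap G H) :
  homotopic (gcomp (gcomp k h) f) (gcomp k (gcomp h f)).
Proof. by apply: homotopic_eq => //= e; rewrite gw_gcomp. Qed.

Lemma gcomp1g (G H : graph) (f : gmap G H) : homotopic (gcomp (gid H) f) f.
Proof. by apply: homotopic_eq => //= e; rewrite gw_gid. Qed.

Lemma gcompg1 (G H : graph) (f : gmap G H) : homotopic (gcomp f (gid G)) f.
Proof. by apply: homotopic_eq => //= e; rewrite gw1. Qed.

Definition homotopy_equiv (G H : graph) (f : gmap G H) : Prop :=
  exists h : gmap H G,
    homotopic (gcomp h f) (gid G) /\ homotopic (gcomp f h) (gid H).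

Let comp_inv (G H K : graph) (f : gmap G H) (f' : gmap H G)
    (h : gmap H K) (h' : gmap K H) :
  homotopic (gcomp f' f) (gid G) -> homotopic (gcomp h' h) (gid H) ->
  homotopic (gcomp (gcomp f' h') (gcomp h f)) (gid G).
Proof.
move=> f'f h'h; apply: homotopic_trans f'f.
apply: homotopic_trans (gcompA _ _ _) _; apply: homotopic_compl.
apply: homotopic_trans (homotopic_sym (gcompA _ _ _)) _.
by apply: homotopic_trans (homotopic_compr _ h'h) _; exact: gcomp1g.
Qed.

Lemma homotopy_equiv_comp (G H K : graph) (h : gmap H K) (f : gmap G H) :
  homotopy_equiv f -> homotopy_equiv h -> homotopy_equiv (gcomp h f).
Proof.
by move=> [f' [f'f ff']] [h' [h'h hh']]; exists (gcomp f' h'); split; apply: comp_inv.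
Qed.

End Homotopy.

(** * The free group, as the fundamental group of the rose *)

Definition rose (n : nat) : graph :=
  @Graph 1 n (fun=> ord0) (fun=> ord0).

Lemma rose_walk n (u v : vert (rose n)) (p : seq (dart (rose n))) : is_walk u p v.
Proof.
elim: p u => [|d p IH] u /=; first by rewrite [u]ord1 [v]ord1.
by rewrite IH andbT [u]ord1 [dsrc d]ord1.
Qed.

Section FreeGroup.
Variable n : nat.

Definition word_eq : rel (seq (dart (rose n))) := fun p q => `[< whtpy p q >].

Lemma word_eq_refl : reflexive word_eq.
Proof. by move=> p; apply/asboolP; exact: whtpy_refl. Qed.
Lemma word_eq_sym : symmetric word_eq.
Proof. by move=> p q; apply/asboolP/asboolP; exact: whtpy_sym. Qed.
Lemma word_eq_trans : transitive word_eq.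
Proof.
by move=> q p r /asboolP pq /asboolP qr; apply/asboolP; exact: whtpy_trans pq qr.
Qed.

Canonical word_equiv := EquivRel word_eq word_eq_refl word_eq_sym word_eq_trans.

Definition freegrp := {eq_quot word_eq}.
HB.instance Definition _ := Choice.on freegrp.
HB.instance Definition _ := EqQuotient.on freegrp.

Definition fword (p : seq (dart (rose n))) : freegrp := \pi_(freegrp) p.

Lemma fwordP p q : fword p = fword q <-> whtpy p q.
Proof.
split=> [/eqP|pq].
  by rewrite /fword eqmodE => /asboolP.
by apply/eqP; rewrite /fword eqmodE; apply/asboolP.
Qed.

Lemma fwordK (x : freegrp) : fword (repr x) = x.
Proof. exact: reprK. Qed.

Lemma repr_fword p : whtpy (repr (fword p)) p.
Proof. by apply/fwordP; exact: fwordK. Qed.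

Definition fmul (x y : freegrp) : freegrp := fword (repr x ++ repr y).
Definition finv (x : freegrp) : freegrp := fword (wrev (repr x)).
Definition fone : freegrp := fword [::].

Lemma fmulE p q : fmul (fword p) (fword q) = fword (p ++ q).
Proof. by apply/fwordP; apply: whtpy_cat; exact: repr_fword. Qed.
Lemma finvE p : finv (fword p) = fword (wrev p).
Proof. by apply/fwordP; apply: whtpy_wrev; exact: repr_fword. Qed.

Lemma fmulA : associative fmul.
Proof.
by move=> x y z; rewrite -[x]fwordK -[y]fwordK -[z]fwordK !fmulE catA.
Qed.
Lemma fmul1 : left_id fone fmul.
Proof. by move=> x; rewrite -[x]fwordK /fone fmulE. Qed.
Lemma f1mul : right_id fone fmul.
Proof. by move=> x; rewrite -[x]fwordK /fone fmulE cats0. Qed.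
Lemma fmulV : left_inverse fone finv fmul.
Proof.
by move=> x; rewrite -[x]fwordK finvE fmulE; apply/fwordP; exact: whtpy_wrevl.
Qed.
Lemma fVmul : right_inverse fone finv fmul.
Proof.
by move=> x; rewrite -[x]fwordK finvE fmulE; apply/fwordP; exact: whtpy_wrevr.
Qed.

HB.instance Definition _ := isGroup.Build freegrp fmulA fmul1 f1mul fmulV fVmul.

Lemma fwordM p q : fword (p ++ q) = (fword p * fword q)%g.
Proof. by rewrite -fmulE. Qed.
Lemma fwordV p : fword (wrev p) = (fword p)^-1%g.
Proof. by rewrite -finvE. Qed.

Definition fgen (i : 'I_n) : freegrp := fword [:: ((i : edge (rose n)), true)].

End FreeGroup.

(** ** Out(F_n) *)

Section Out.
Local Open Scope group_scope.
Variable n : nat.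
Local Notation F := (freegrp n).

Record faut := FAut {
  af :> F -> F;
  afV : F -> F;
  afM : {morph af : x y / x * y};
  afK : cancel af afV;
  afVK : cancel afV af }.

HB.instance Definition _ := gen_eqMixin faut.
HB.instance Definition _ := gen_choiceMixin faut.

Lemma afVM (f : faut) : {morph afV f : x y / x * y}.
Proof. by move=> x y; rewrite -{1}[x](afVK f) -{1}[y](afVK f) -afM afK. Qed.

Lemma af1 (f : faut) : f 1 = 1.
Proof. by apply: (mulgI (f 1)); rewrite -afM !mulg1. Qed.

Lemma afInv (f : faut) x : f x^-1 = (f x)^-1.
Proof. by apply: (mulgI (f x)); rewrite -afM !mulgV af1. Qed.

Lemma afJ (f : faut) x y : f (x ^ y) = f x ^ f y.
Proof. by rewrite !conjgE !afM afInv. Qed.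

Definition faut1 : faut := @FAut id id (fun _ _ => erefl) (fun=> erefl) (fun=> erefl).

Definition fautV (f : faut) : faut := FAut (afVM f) (@afVK f) (@afK f).

Lemma faut_compM (f h : faut) : {morph f \o h : x y / x * y}.
Proof. by move=> x y; rewrite /= !afM. Qed.

Definition faut_comp (f h : faut) : faut :=
  FAut (faut_compM f h) (can_comp (@afK f) (@afK h)) (can_comp (@afVK h) (@afVK f)).

Definition inner_eq : rel faut := fun f h => `[< exists w, forall x, h x = f x ^ w >].

Lemma inner_eq_refl : reflexive inner_eq.
Proof. by move=> f; apply/asboolP; exists 1 => x; rewrite conjg1. Qed.
Lemma inner_eq_sym : symmetric inner_eq.
Proof.
have S f h : inner_eq f h -> inner_eq h f.
  by move=> /asboolP[w fh]; apply/asboolP; exists w^-1 => x; rewrite fh conjgK.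
by move=> f h; apply/idP/idP; exact: S.
Qed.
Lemma inner_eq_trans : transitive inner_eq.
Proof.
move=> h f k /asboolP[w fh] /asboolP[v hk]; apply/asboolP; exists (w * v) => x.
by rewrite hk fh conjgM.
Qed.

Canonical inner_equiv := EquivRel inner_eq inner_eq_refl inner_eq_sym inner_eq_trans.

Definition out := {eq_quot inner_eq}.
HB.instance Definition _ := Choice.on out.
HB.instance Definition _ := EqQuotient.on out.

Definition outer (f : faut) : out := \pi_(out) f.

Lemma outerP f h : outer f = outer h <-> exists w, forall x, h x = f x ^ w.
Proof.
split=> [/eqP|fh].
  by rewrite /outer eqmodE => /asboolP.
by apply/eqP; rewrite /outer eqmodE; apply/asboolP.
Qed.

Lemma outerK (o : out) : outer (repr o) = o.
Proof. exact: reprK. Qed.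

Definition omul (o o' : out) : out := outer (faut_comp (repr o) (repr o')).
Definition oinv (o : out) : out := outer (fautV (repr o)).
Definition oone : out := outer faut1.

Lemma omulE f h : omul (outer f) (outer h) = outer (faut_comp f h).
Proof.
have /outerP[w fw] := outerK (outer f); have /outerP[v hv] := outerK (outer h).
apply/outerP; exists ((repr (outer f)) v * w) => x /=.
by rewrite fw hv afJ conjgM.
Qed.

Lemma oinvE f : oinv (outer f) = outer (fautV f).
Proof.
have /outerP[w fw] := outerK (outer f).
apply/outerP; exists (fautV (repr (outer f)) w^-1) => x.
by rewrite -afJ /= -[in RHS](afVK f x) fw conjgK afK.
Qed.

Lemma omulA : associative omul.
Proof.
move=> a b c; rewrite -[a]outerK -[b]outerK -[c]outerK !omulE.
by apply/outerP; exists 1 => x; rewrite conjg1.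
Qed.
Lemma omul1 : left_id oone omul.
Proof.
by move=> a; rewrite -[a]outerK omulE; apply/outerP; exists 1 => x; rewrite conjg1.
Qed.
Lemma o1mul : right_id oone omul.
Proof.
by move=> a; rewrite -[a]outerK omulE; apply/outerP; exists 1 => x; rewrite conjg1.
Qed.
Lemma omulV : left_inverse oone oinv omul.
Proof.
move=> a; rewrite -[a]outerK oinvE omulE; apply/outerP; exists 1 => x.
by rewrite conjg1 /= afK.
Qed.
Lemma oVmul : right_inverse oone oinv omul.
Proof.
move=> a; rewrite -[a]outerK oinvE omulE; apply/outerP; exists 1 => x.
by rewrite conjg1 /= afVK.
Qed.

HB.instance Definition _ := isGroup.Build out omulA omul1 o1mul omulV oVmul.

(* The self-map of the rose sending the [i]-th petal to a word for [f x_i];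
   it induces [f] on the fundamental group. *)
Definition rose_map (f : F -> F) : gmap (rose n) (rose n) :=
  @GMap (rose n) (rose n) id (fun i => repr (f (fgen i))) (fun e => rose_walk _ _ _).

Lemma fword_rose_map (f : faut) p : fword (gw (rose_map f) p) = f (fword p).
Proof.
elim: p => [|d p IH]; first exact/esym/(af1 f).
rewrite gw_cons fwordM IH -[d :: p]cat1s fwordM afM; congr (_ * _).
case: d => e []; rewrite /gd /=; first exact: fwordK.
by rewrite fwordV fwordK -afInv -fwordV.
Qed.

Lemma rose_map_comp (f h : faut) :
  homotopic (gcomp (rose_map f) (rose_map h)) (rose_map (faut_comp f h)).
Proof.
apply: homotopic_eqv => // e; apply/fwordP.
by rewrite fword_rose_map !fwordK.
Qed.

Lemma rose_map1 : homotopic (rose_map faut1) (gid (rose n)).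
Proof. by apply: homotopic_eqv => // e; apply/fwordP; rewrite fwordK. Qed.

Lemma rose_map_inner (f h : faut) :
  inner_eq f h -> homotopic (rose_map f) (rose_map h).
Proof.
move=> /asboolP[w fh]; exists (fun=> repr w); split=> [v|e]; first exact: rose_walk.
apply/fwordP; rewrite !fwordM !fwordK fh conjgE.
by rewrite mulgA mulgV mul1g.
Qed.

Lemma rose_map_he (f : faut) : homotopy_equiv (rose_map f).
Proof.
exists (rose_map (fautV f)); split; apply: homotopic_trans (rose_map_comp _ _) _.
  apply: homotopic_trans (rose_map_inner _) rose_map1.
  by apply/asboolP; exists 1 => x; rewrite conjg1 /= afK.
apply: homotopic_trans (rose_map_inner _) rose_map1.
by apply/asboolP; exists 1 => x; rewrite conjg1 /= afVK.
Qed.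

End Out.

(** * Outer space *)

(* The marked graph [(G, g)] without edge lengths, which indexes the simplices. *)
Record marked (n : nat) := Marked {
  mgraph :> graph;
  mgraph_outer : outer_graph mgraph;
  marking : gmap (rose n) mgraph;
  marking_he : homotopy_equiv marking }.

Section OuterSpace.
Local Open Scope classical_set_scope.
Local Open Scope ring_scope.
Variables (R : realType) (n : nat).

(* The coordinates are indexed by the edges of [G]. *)
Definition simplex (G : graph) : set 'rV[R]_(nedge G) :=
  [set x | (forall e, 0 <= x 0 e) /\ \sum_e x 0 e = 1].

Definition open_simplex (G : graph) : set 'rV[R]_(nedge G) :=
  [set x | (forall e, 0 < x 0 e) /\ \sum_e x 0 e = 1].

Definition zero_edges (G : graph) (x : 'rV[R]_(nedge G)) : {set edge G} :=
  [set e : edge G | x 0 e == 0]%SET.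

(* The simplex with missing faces. *)
Definition bar_simplex (G : graph) : set 'rV[R]_(nedge G) :=
  [set x | simplex x /\ ~ contains_loop (zero_edges x)].

Record metric_marked := MetricMarked {
  mmarked :> marked n;
  mlen : 'rV[R]_(nedge mmarked);
  mlenP : open_simplex mlen }.

HB.instance Definition _ := gen_eqMixin metric_marked.
HB.instance Definition _ := gen_choiceMixin metric_marked.

(* As there are no bivalent vertices, an isometry takes vertices to vertices
   and edges to edges; [s e'] is the edge taken to [e'] by [f]. *)
Definition isometry (G H : graph) (f : gmap G H) (s : edge H -> edge G)
    (x : 'rV[R]_(nedge G)) (y : 'rV[R]_(nedge H)) : Prop :=
  [/\ bijective (gv f), bijective s,
      forall e', exists b, ge f (s e') = [:: (e', b)] &
      forall e', y 0 e' = x 0 (s e')].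

Definition same_class (X Y : metric_marked) : Prop :=
  exists (f : gmap X Y) (s : edge Y -> edge X),
    isometry f s (mlen X) (mlen Y) /\
    homotopic (gcomp f (marking X)) (marking Y).

Definition same_point : rel metric_marked := fun X Y => `[< same_class X Y >].

Lemma same_point_refl : reflexive same_point.
Proof.
move=> X; apply/asboolP; exists (gid X), id; split; last exact: gcomp1g.
by split=> //; [exists id | exists id | move=> e; exists true].
Qed.

Lemma same_point_trans : transitive same_point.
Proof.
move=> Y X Z /asboolP[f [s [[vf bs fs lf] hf]]] /asboolP[h [t [[vh bt ht lh] hh]]].
apply/asboolP; exists (gcomp h f), (s \o t); split; first split.
- exact: bij_comp.
- exact: bij_comp.
- move=> e /=; have [b ->] := fs (t e); have [c hc] := ht e.
  by rewrite gw1 /gd /=; case: b; rewrite hc; [exists c | exists (~~ c)].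
- by move=> e; rewrite lh lf.
- apply: homotopic_trans (gcompA _ _ _) _.
  by apply: homotopic_trans (homotopic_compl _ hf) _.
Qed.

Lemma same_point_sym : symmetric same_point.
Proof.
suff S X Y : same_point X Y -> same_point Y X by move=> X Y; apply/idP/idP; exact: S.
move=> /asboolP[f [s [[[k fK kK] [t sK tK] fs lf] hf]]].
pose b e' := (head (e', true) (ge f (s e'))).2.
have fb e' : ge f (s e') = [:: (e', b e')] by rewrite /b; have [c ->] := fs e'.
have kP (e' : edge Y) : is_walk (k (src e')) [:: (s e', b e')] (k (tgt e')).
  have := geP f (s e'); rewrite fb /= /dsrc /dtgt /=.
  by case: (b e') => /andP[/eqP e1 /eqP e2]; rewrite e1 e2 !fK !eqxx.
pose h : gmap Y X := GMap kP.
have hf1 : homotopic (gcomp h f) (gid X).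
  apply: homotopic_eq => //= e; rewrite -[e]tK fb gw1 /gd /=.
  by case: (b _) => //=; rewrite /wrev /= /drev /=.
apply/asboolP; exists h, t; split; first split.
- by exists (gv f).
- by exists s.
- by move=> e; exists (b (t e)); rewrite /= tK.
- by move=> e; rewrite lf tK.
- apply: homotopic_trans (homotopic_compl h (homotopic_sym hf)) _.
  apply: homotopic_trans (homotopic_sym (gcompA _ _ _)) _.
  by apply: homotopic_trans (homotopic_compr _ hf1) _; exact: gcomp1g.
Qed.

Canonical same_point_equiv :=
  EquivRel same_point same_point_refl same_point_sym same_point_trans.

Definition outer_space := {eq_quot same_point}.
HB.instance Definition _ := Choice.on outer_space.
HB.instance Definition _ := EqQuotient.on outer_space.

Definition opoint (X : metric_marked) : outer_space := \pi_(outer_space) X.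

Lemma opointP X Y : opoint X = opoint Y <-> same_point X Y.
Proof.
split=> [/eqP|XY]; first by rewrite /opoint eqmodE.
by apply/eqP; rewrite /opoint eqmodE.
Qed.

Lemma opointK p : opoint (repr p) = p.
Proof. exact: reprK. Qed.

(** ** Topology *)

(* [f : G -> H] collapses each component of the subgraph [A] to a point and
   induces an isomorphism from the quotient of [G] by these collapses to [H];
   [s] maps each edge of [H] to the corresponding edge of [G]. *)
Definition collapse (G H : graph) (A : {set edge G}) (f : gmap G H)
    (s : edge H -> edge G) : Prop :=
  [/\ forall w, exists u, gv f u = w,
      forall u v, gv f u = gv f v <-> connect (adj A) u v,
      injective s /\ (forall e, (e \in A) = (e \notin codom s)),
      forall e, e \in A -> ge f e = [::] &
      forall e', exists b, ge f (s e') = [:: (e', b)]].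

(* [p] is the image in outer space of the point [x] of the simplex with missing
   faces of the marked graph [M]: the edges of length 0 are collapsed. *)
Definition realizes (M : marked n) (x : 'rV[R]_(nedge M)) (p : outer_space) : Prop :=
  bar_simplex x /\
  exists Y : metric_marked, p = opoint Y /\
    exists (f : gmap M Y) (s : edge Y -> edge M),
      [/\ collapse (zero_edges x) f s,
          forall e', mlen Y 0 e' = x 0 (s e') &
          homotopic (gcomp f (marking M)) (marking Y)].

(* The final topology for the maps from the simplices with missing faces: [U] is open when its inverse image in each simplex with
   missing faces is relatively open, i.e. the trace of an open set [W]. *)
Definition outer_open : set_system outer_space :=
  [set U | forall M : marked n, exists W : set 'rV[R]_(nedge M),
    open W /\ forall x p, realizes x p -> (U p <-> W x)].

Lemma outer_openT : outer_open setT.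
Proof. by move=> M; exists setT; split; [exact: openT | ]. Qed.

Lemma outer_openI : setI_closed outer_open.
Proof.
move=> U V oU oV M; have [W [oW UW]] := oU M; have [W' [oW' VW']] := oV M.
exists (W `&` W'); split; first exact: openI.
by move=> x p xp; split=> -[? ?]; split; [apply/(UW _ _ xp) | apply/(VW' _ _ xp)
  | apply/(UW _ _ xp) | apply/(VW' _ _ xp)].
Qed.

Lemma outer_open_bigU (I : Type) (U : I -> set outer_space) :
  (forall i, outer_open (U i)) -> outer_open (\bigcup_i U i).
Proof.
move=> oU M; have /choice[W WP] : forall i, exists W : set 'rV[R]_(nedge M),
    open W /\ forall x p, realizes x p -> (U i p <-> W x) by move=> i; exact: oU.
exists (\bigcup_i W i); split; first by apply: bigcup_open => i _; have [] := WP i.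
by move=> x p xp; split=> -[i _ ip]; exists i => //; apply/((WP i).2 _ _ xp).
Qed.

HB.instance Definition _ :=
  isOpenTopological.Build outer_space outer_openT outer_openI outer_open_bigU.

Lemma outer_openE (U : set outer_space) : open U <-> outer_open U.
Proof.
split=> [|oU]; rewrite openE; last by move=> p Up; exists U; split.
move=> oU; have -> : U = \bigcup_(i : {V : set outer_space | outer_open V /\ V `<=` U})
    (proj1_sig i).
  apply/seteqP; split=> [p /oU [V [oV Vp VU]]|p [[V [oV VU]] _ /= /VU]] //.
  by exists (exist _ V (conj oV VU)).
by apply: outer_open_bigU => -[V []].
Qed.

(** ** The action of Out(F_n) *)

(* A right action, by precomposition of the markings. *)
Definition mark_change (f : faut n) (X : metric_marked) : metric_marked :=
  MetricMarked (mmarked := Marked (mgraph_outer X)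
      (homotopy_equiv_comp (rose_map_he f) (marking_he X)))
    (@mlenP X).

Definition act (p : outer_space) (o : out n) : outer_space :=
  opoint (mark_change (repr o) (repr p)).

Lemma actE X f : act (opoint X) (outer f) = opoint (mark_change f X).
Proof.
have /opointP/asboolP[g [s [gs hg]]] := opointK (opoint X).
apply/opointP/asboolP; exists g, s; split=> //=.
apply: homotopic_trans (homotopic_sym (gcompA _ _ _)) _.
apply: homotopic_trans (homotopic_compr _ hg) _; apply: homotopic_compl.
by apply: rose_map_inner; apply/asboolP/outerP; exact: outerK.
Qed.

Lemma act1 p : act p 1%g = p.
Proof.
rewrite -[p]opointK actE; apply/opointP/asboolP; exists (gid _), id; split.
  by split=> //; [exists id | exists id | move=> e; exists true].
apply: homotopic_trans (gcomp1g _) _.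
by apply: homotopic_trans (homotopic_compl _ (rose_map1 n)) _; exact: gcompg1.
Qed.

Lemma actM p a b : act p (a * b)%g = act (act p a) b.
Proof.
have -> : (a * b)%g = outer (faut_comp (repr a) (repr b)) by [].
rewrite -[a in RHS]outerK -[b in RHS]outerK -[p]opointK !actE.
apply/opointP/asboolP; exists (gid _), id; split.
  by split=> //; [exists id | exists id | move=> e; exists true].
apply: homotopic_trans (gcomp1g _) _.
apply: homotopic_trans (homotopic_sym (gcompA _ _ _)).
by apply: homotopic_compl; apply: homotopic_sym; exact: rose_map_comp.
Qed.

(** ** Jewels *)

(* [c r] is the constant c_r; only [c 1], ..., [c n] matter. *)
Definition jewel (c : nat -> R) (G : graph) : set 'rV[R]_(nedge G) :=
  [set x | simplex x /\ forall A : {set edge G}, A != finset.set0 -> core A ->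
    c (rankH1 A) <= \sum_(e in A) x 0 e].

Definition jewel_space (c : nat -> R) : set outer_space :=
  [set p | exists (M : marked n) (x : 'rV[R]_(nedge M)),
    jewel c x /\ realizes x p].

End OuterSpace.

Section Retract.
Local Open Scope classical_set_scope.
Local Open Scope ring_scope.
Variables (R : realType) (T : topologicalType) (g : groupType).
Variable a : T -> g -> T.

(* A deformation retraction of [T] onto [J], fixing [J] pointwise throughout,
   by maps which commute with the action of [g]. *)
Definition equivariant_deformation_retract (J : set T) : Prop :=
  exists H : T * R -> T,
    [/\ {within setT `*` `[0, 1], continuous H},
        forall p, H (p, 0) = p,
        forall p, J (H (p, 1)),
        forall p t, J p -> 0 <= t <= 1 -> H (p, t) = p &
        forall p t o, 0 <= t <= 1 -> H (a p o, t) = a (H (p, t)) o].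

Definition acts_cocompactly (J : set T) : Prop :=
  (forall p o, J p -> J (a p o)) /\
  exists K : set T, [/\ compact K, K `<=` J &
    forall p, J p -> exists q o, K q /\ p = a q o].

End Retract.

(* Main.v *)
Require Import Defs.
From mathcomp Require Import all_boot all_order all_algebra.
From mathcomp Require Import zify lra.
From mathcomp Require Import all_classical all_reals all_analysis.

Set Implicit Arguments.
Unset Strict Implicit.
Unset Printing Implicit Defensive.

Import Order.TTheory GRing.Theory Num.Theory.
Import numFieldNormedType.Exports.

Local Open Scope ring_scope.

(** The retraction is explicit.  For a point [x] of a simplex put
    [gap x = min (1, x(A) / c_A)], the minimum being over the nonempty core
    subgraphs [A]; it is positive away from the missing faces, and equal to 1
    exactly on the jewel.  Keep the edges which are short compared to [gap x],
    shrink the others until the total length is [gap x], and rescale to total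
    length 1.  If the constants are small, a core subgraph with a long edge
    satisfies its inequality thanks to this edge, and one with short edges only is
    enlarged by the factor [1 / gap x], which is what is needed.  The resulting map
    and the straight line homotopy to it preserve the support of [x], so no
    collapse occurs on the way.  They commute with collapses because [gap] does:
    collapsing the edges of length 0 of [x], which form a forest, sends core
    subgraphs to core subgraphs of at least the same rank and the same length, and
    each core subgraph of the quotient comes from one of the same rank.  Hence
    they glue to an equivariant homotopy of Outer space, which is continuous by
    compactness of intervals of time.

    Subgraphs are handled through their rational cycle spaces: an edge is
    nonseparating iff it is in the support of a cycle, a subgraph is a forest iff it
    has no nonzero cycle, and chain maps transport cycles along collapses and
    homotopy equivalences. *)

(** * Cellular chains and cycles *)

Section Chains.
Implicit Types (G H K : graph).

Definition bdmx G : 'M[rat]_(nedge G, nvert G) :=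
  \matrix_(e, v) ((tgt e == v)%:R - (src e == v)%:R).

Lemma row_bdmx G (e : edge G) :
  row e (bdmx G) = delta_mx 0 (tgt e) - delta_mx 0 (src e).
Proof. by apply/rowP => v; rewrite !mxE !eqxx /= ![v == _]eq_sym. Qed.

Lemma bdmxM G k (x : 'M[rat]_(nvert G, k)) (e : edge G) j :
  (bdmx G *m x) e j = x (tgt e) j - x (src e) j.
Proof.
have -> : (bdmx G *m x) e j = row e (bdmx G *m x) 0 j by rewrite [RHS]mxE.
by rewrite row_mul row_bdmx mulmxBl -!rowE !mxE.
Qed.

Definition dsign (b : bool) : rat := if b then 1 else -1.

Lemma dsign_neq0 b : dsign b != 0.
Proof. by case: b; rewrite /dsign ?oppr_eq0 oner_eq0. Qed.

Lemma dsignN b : dsign (~~ b) = - dsign b.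
Proof. by case: b; rewrite /dsign /= ?opprK. Qed.

Lemma dsignM b : dsign b * dsign b = 1.
Proof. by case: b; rewrite /dsign ?mulrNN mulr1. Qed.

Definition wchain G (p : seq (dart G)) : 'rV[rat]_(nedge G) :=
  \sum_(d <- p) dsign d.2 *: delta_mx 0 d.1.

Lemma wchain_nil G : wchain (Nil (dart G)) = 0.
Proof. by rewrite /wchain big_nil. Qed.

Lemma wchain_cons G (d : dart G) p :
  wchain (d :: p) = dsign d.2 *: delta_mx 0 d.1 + wchain p.
Proof. by rewrite /wchain big_cons. Qed.

Lemma wchain_cat G (p q : seq (dart G)) : wchain (p ++ q) = wchain p + wchain q.
Proof. by rewrite /wchain big_cat. Qed.

Lemma wchain_wrev G (p : seq (dart G)) : wchain (wrev p) = - wchain p.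
Proof.
elim: p => [|d p IH]; first by rewrite wchain_nil oppr0.
rewrite wrev_cons wchain_cat IH !wchain_cons wchain_nil addr0 /= dsignN scaleNr.
by rewrite opprD addrC.
Qed.

Lemma wchain_whtpy G (p q : seq (dart G)) : whtpy p q -> wchain p = wchain q.
Proof.
elim=> {p q} [p d q|//|//|q p s _ -> //].
by rewrite !wchain_cat !wchain_cons /= dsignN scaleNr addNKr.
Qed.

Lemma wchain_bd G (u v : vert G) p :
  is_walk u p v -> wchain p *m bdmx G = delta_mx 0 v - delta_mx 0 u.
Proof.
elim: p u => [|d p IH] u /=; first by move/eqP->; rewrite wchain_nil mul0mx subrr.
case/andP=> /eqP <- /IH E; rewrite wchain_cons mulmxDl E -scalemxAl -rowE row_bdmx.
by case: d {E} => e []; rewrite /dsign /dsrc /dtgt /= ?scaleN1r ?scale1r ?opprB addrC subrKA.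
Qed.

Lemma wchain_off G (p : seq (dart G)) (e : edge G) :
  (forall d, d \in p -> d.1 != e) -> wchain p 0 e = 0.
Proof.
move=> pe; rewrite /wchain summxE big1_seq // => d /andP[_ /pe de].
by rewrite !mxE eqxx /= [e == _]eq_sym (negbTE de) mulr0.
Qed.

Definition gmx G H (f : gmap G H) : 'M[rat]_(nedge G, nedge H) :=
  \matrix_(e < nedge G) wchain (ge f e).

Definition gvmx G H (f : gmap G H) : 'M[rat]_(nvert G, nvert H) :=
  \matrix_(v < nvert G) (delta_mx 0 (gv f v) : 'rV_(nvert H)).

Lemma gmx_bd G H (f : gmap G H) : gmx f *m bdmx H = bdmx G *m gvmx f.
Proof.
apply/row_matrixP => e; rewrite !row_mul row_bdmx rowK (wchain_bd (geP f e)).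
by rewrite mulmxBl -!rowE !rowK.
Qed.

Lemma gmx_cycle G H (f : gmap G H) (z : 'rV_(nedge G)) :
  z *m bdmx G = 0 -> (z *m gmx f) *m bdmx H = 0.
Proof. by move=> z0; rewrite -mulmxA gmx_bd mulmxA z0 mul0mx. Qed.

Lemma gmx_id G : gmx (gid G) = 1%:M.
Proof.
apply/row_matrixP => e; rewrite rowK row1 /= wchain_cons wchain_nil addr0.
by rewrite /dsign /= scale1r.
Qed.

Lemma wchain_gd G H (f : gmap G H) d : wchain (gd f d) = dsign d.2 *: wchain (ge f d.1).
Proof. by case: d => e []; rewrite /gd /dsign /= ?wchain_wrev ?scaleN1r ?scale1r. Qed.

Lemma wchain_gw G H (f : gmap G H) p : wchain (gw f p) = wchain p *m gmx f.
Proof.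
elim: p => [|d p IH]; first by rewrite !wchain_nil mul0mx.
by rewrite gw_cons wchain_cat IH wchain_cons mulmxDl -scalemxAl -rowE rowK wchain_gd.
Qed.

Lemma gmx_comp G H K (h : gmap H K) (f : gmap G H) :
  gmx (gcomp h f) = gmx f *m gmx h.
Proof. by apply/row_matrixP => e; rewrite row_mul !rowK -wchain_gw. Qed.

(* The track of a homotopy provides a chain homotopy. *)
Lemma gmx_homotopic G H (f f' : gmap G H) (z : 'rV_(nedge G)) :
  homotopic f f' -> z *m bdmx G = 0 -> z *m gmx f = z *m gmx f'.
Proof.
move=> [p [_ hp]] z0; pose T := \matrix_(v < nvert G) wchain (p v).
have -> : gmx f = gmx f' - bdmx G *m T.
  apply/row_matrixP => e; rewrite linearB /= row_mul row_bdmx mulmxBl -!rowE !rowK.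
  have := wchain_whtpy (hp e); rewrite !wchain_cat => E.
  by rewrite opprB addrA [_ + wchain (p _)]addrC -E addrK.
by rewrite mulmxBr mulmxA z0 mul0mx subr0.
Qed.

End Chains.

(** * Rational cycle spaces of subgraphs *)

Section Cycles.
Variable G : graph.
Implicit Types (A B : {set edge G}) (z : 'rV[rat]_(nedge G)).

Definition cycle_in B z : Prop :=
  z *m bdmx G = 0 /\ forall e, e \notin B -> z 0 e = 0.

(** The second block reads off the coefficients outside [B], so the row space of this kernel
    consists of the cycles of [B]. Unlike the kernel in [rankH1], it lies in the chains of the whole
    graph, where the cycles of different subgraphs can be compared. *)
Definition cyclemx B : 'M[rat]_(nedge G) :=
  kermx (row_mx (bdmx G) (diag_mx (\row_e (e \notin B)%:R))).

Lemma cyclemxP B z : reflect (cycle_in B z) (z <= cyclemx B)%MS.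
Proof.
rewrite /cyclemx; apply: (iffP sub_kermxP).
  rewrite mul_mx_row => /eqP; rewrite row_mx_eq0 => /andP[/eqP z0 /eqP zB].
  split=> // e eB; move/rowP/(_ e): zB; rewrite mul_mx_diag !mxE eB mulr1 //.
case=> z0 zB; apply/eqP; rewrite mul_mx_row row_mx_eq0 z0 eqxx /=.
apply/eqP/rowP => e; rewrite mul_mx_diag !mxE.
by have [eB|/zB ->] := boolP (e \in B); rewrite ?mulr0 ?mul0r.
Qed.

Lemma cycle_inS A B z : A \subset B -> cycle_in A z -> cycle_in B z.
Proof. by move=> /fintype.subsetP AB [z0 zA]; split=> // e eB; apply/zA/(contra (AB e)). Qed.

(** Extension by zero [S], with restriction [S^T] as inverse on chains supported in [B], identifies
    the kernel of [boundary B] with the cycles supported in [B]. *)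
Lemma rankH1E B : rankH1 B = \rank (cyclemx B).
Proof.
pose S : 'M[rat]_(#|B|, nedge G) := \matrix_(i < #|B|) delta_mx 0 (enum_val i).
have bdE : boundary B = S *m bdmx G.
  apply/row_matrixP => i; rewrite row_mul rowK -rowE row_bdmx.
  by apply/rowP => v; rewrite !mxE !eqxx /= ![v == _]eq_sym.
have SB w : forall e, e \notin B -> (w *m S) 0 e = 0 :> rat.
  move=> e eB; rewrite mxE big1 // => i _; rewrite !mxE eqxx /=.
  have [E|] := eqVneq e (enum_val i); last by rewrite mulr0.
  by rewrite E enum_valP in eB.
have SST : S *m S^T = 1%:M.
  apply/matrixP => i j; rewrite !mxE (bigD1 (enum_val i)) //= big1 => [|k /negbTE ki].
    by rewrite !mxE !eqxx /= mul1r addr0 (inj_eq enum_val_inj).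
  by rewrite !mxE ki andbF mul0r.
have SS z : cycle_in B z -> z *m S^T *m S = z.
  move=> [_ zB]; apply/rowP => e; have [eB|eB] := boolP (e \in B); last first.
    by rewrite SB // zB.
  rewrite mxE (bigD1 (enum_rank_in eB e)) //= big1 => [|i ie]; last first.
    rewrite !mxE eqxx /=; have [E|] := eqVneq e (enum_val i); last by rewrite mulr0.
    by case/eqP: ie; apply: enum_val_inj; rewrite -E enum_rankK_in.
  rewrite !mxE enum_rankK_in // !eqxx /= mulr1 addr0 (bigD1 e) //= big1 => [|k ke].
    by rewrite !mxE enum_rankK_in // !eqxx mulr1 addr0.
  by rewrite !mxE enum_rankK_in // (negbTE ke) andbF mulr0.
apply/eqP; rewrite eqn_leq /rankH1; apply/andP; split.
  have Sfree : row_free S by apply/row_freeP; exists S^T.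
  rewrite -(mxrankMfree _ Sfree); apply/mxrankS/row_subP => i; rewrite row_mul.
  apply/cyclemxP; split; last exact: SB.
  by rewrite -mulmxA -bdE -row_mul mulmx_ker row0.
have -> : cyclemx B = cyclemx B *m S^T *m S.
  apply/row_matrixP => i; rewrite [RHS]row_mul [row i (_ *m _)]row_mul SS //.
  by apply/cyclemxP; exact: row_sub.
apply: leq_trans (mxrankM_maxl _ _) _; apply/mxrankS/row_subP => i; rewrite row_mul.
have /cyclemxP zc : (row i (cyclemx B) <= cyclemx B)%MS by exact: row_sub.
by apply/sub_kermxP; rewrite bdE mulmxA SS //; case: zc.
Qed.

End Cycles.

Lemma leq_rankH1 (G H : graph) (B : {set edge G}) (C : {set edge H})
    (L : 'M[rat]_(nedge G, nedge H)) :
  (forall z, cycle_in B z -> cycle_in C (z *m L)) ->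
  (forall z, cycle_in B z -> z *m L = 0 -> z = 0) ->
  (rankH1 B <= rankH1 C)%N.
Proof.
move=> BC inj; rewrite !rankH1E -(mxrank_mul_ker (cyclemx B) L).
have -> : (cyclemx B :&: kermx L)%MS = 0.
  apply/eqP/rowV0P => z; rewrite sub_capmx => /andP[/cyclemxP zB /sub_kermxP zL].
  exact: inj zL.
rewrite mxrank0 addn0; apply/mxrankS/row_subP => i; rewrite row_mul.
by apply/cyclemxP/BC/cyclemxP; exact: row_sub.
Qed.

Lemma rankH1_gt0 (G : graph) (B : {set edge G}) z :
  cycle_in B z -> z != 0 -> (0 < rankH1 B)%N.
Proof.
move=> /cyclemxP zB z0; rewrite rankH1E lt0n mxrank_eq0.
by apply: contra z0 => /eqP E; move: zB; rewrite E submx0.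
Qed.

(** The chain map of a homotopy inverse [h] is injective on cycles, because following it by [g]
    fixes every cycle; and the chains of the rose have dimension [n]. *)
Lemma rankH1_homotopy_equiv (n : nat) (G : graph) (g : gmap (rose n) G) (B : {set edge G}) :
  homotopy_equiv g -> (rankH1 B <= n)%N.
Proof.
move=> [h [_ gh]].
have hn : (rankH1 [set: edge (rose n)] <= n)%N by rewrite rankH1E rank_leq_row.
apply: leq_trans hn; apply: (@leq_rankH1 _ _ _ _ (gmx h)) => z [z0 _].
  by split; [exact: gmx_cycle | move=> e; rewrite inE].
move=> zh; rewrite -[z]mulmx1 -gmx_id -(gmx_homotopic gh z0) gmx_comp mulmxA zh.
by rewrite mul0mx.
Qed.

(** * Separating edges, loops and cores *)

(** Sending the root of each [r']-component to its [r]-root embeds the components of [r'] into those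
    of [r]. If this were onto, every point of [a] would be [r]-connected to the root of its
    [r']-component, and so [x] to [y]. *)
Lemma ltn_n_comp (T : finType) (r r' : rel T) (a : {pred T}) (x y : T) :
    symmetric r -> symmetric r' -> subrel r r' -> fingraph.closed r' a ->
    x \in a -> connect r' x y -> ~~ connect r x y ->
  (n_comp r' a < n_comp r a)%N.
Proof.
move=> /sym_connect_sym sr /sym_connect_sym sr' rr' ca xa xy nxy.
have cr : fingraph.closed r a by move=> u v uv; apply/ca/rr'.
have ya : y \in a by rewrite -(closed_connect ca xy).
have sub u v : connect r u v -> connect r' u v.
  by apply: connect_sub => {}u {}v uv; apply/connect1/rr'.
have ra u : (fingraph.root r u \in a) = (u \in a).
  by rewrite -(closed_connect cr (connect_root r u)).
pose I := [set u | roots r' u && (u \in a)]%SET.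
pose J := [set u | roots r u && (u \in a)]%SET.
have -> : n_comp r' a = #|[set fingraph.root r u | u in I]%SET|.
  rewrite card_in_imset ?cardsE; first exact: eq_card.
  move=> u v; rewrite !inE => /andP[/eqP ur _] /andP[/eqP vr _].
  by move/(fingraph.rootP sr)/sub/(fingraph.rootP sr'); rewrite ur vr.
have -> : n_comp r a = #|J| by rewrite cardsE; apply: eq_card.
have IJ : [set fingraph.root r u | u in I]%SET \subset J.
  apply/fintype.subsetP => x1 /imsetP[u uI ->]; move: uI; rewrite !inE => /andP[_ ua].
  by rewrite ra ua andbT roots_root.
apply: proper_card; rewrite properE IJ /=; apply/negP => /fintype.subsetP JI.
have rJ u : u \in a -> fingraph.root r u \in J by move=> ua; rewrite !inE ra ua andbT roots_root.
have rI u : u \in a -> connect r u (fingraph.root r' u).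
  move=> /rJ/JI/imsetP[v]; rewrite !inE => /andP[/eqP vr _] /(fingraph.rootP sr) uv.
  by have /(fingraph.rootP sr') -> := sub _ _ uv; rewrite vr.
have /(fingraph.rootP sr') xy' := xy; case/negP: nxy.
by apply: connect_trans (rI _ xa) _; rewrite xy' sr; exact: rI.
Qed.

Section Connectivity.
Variable G : graph.
Implicit Types (A B : {set edge G}) (e : edge G) (u v : vert G).

Lemma adj_sym A : symmetric (adj A).
Proof. by move=> u v; apply: eq_existsb => e; rewrite orbC. Qed.

Lemma adjP A u v :
  reflect (exists d : dart G, [/\ d.1 \in A, dsrc d = u & dtgt d = v]) (adj A u v).
Proof.
apply: (iffP existsP) => [[e /andP[eA /orP[]/andP[/eqP <- /eqP <-]]]|].
- by exists (e, true).
- by exists (e, false).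
case=> -[e b] [/= eA <- <-]; exists e; rewrite eA /dsrc /dtgt /=.
by case: b; rewrite !eqxx ?orbT.
Qed.

Lemma adj_edge A e : e \in A -> adj A (src e) (tgt e).
Proof. by move=> eA; apply/adjP; exists (e, true). Qed.

Lemma adjS A B : A \subset B -> subrel (adj A) (adj B).
Proof.
by move=> /fintype.subsetP AB u v /adjP[d [dA du dv]]; apply/adjP; exists d; split=> //; exact: AB.
Qed.

Lemma closed_sverts A : fingraph.closed (adj A) (mem (sverts A)).
Proof.
apply: (intro_closed (sym_connect_sym (adj_sym A))) => u v /existsP[e /andP[eA uv]] _.
rewrite inE; apply/existsP; exists e; rewrite eA.
by case/orP: uv => /andP[h1 h2]; rewrite ?h1 ?h2 ?orbT.
Qed.

Lemma separatesE A e : e \in A ->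
  separates A e = ~~ connect (adj (A :\ e)) (src e) (tgt e).
Proof.
move=> eA; have sA : subrel (adj (A :\ e)) (adj A) by exact/adjS/subsetDl.
have [c|nc] := boolP (connect _ _ _); last first.
  apply: (ltn_n_comp (x := src e) (y := tgt e)) => //; try exact: adj_sym.
  - exact: closed_sverts.
  - by rewrite inE; apply/existsP; exists e; rewrite eA eqxx.
  - exact/connect1/adj_edge.
apply/negbTE; rewrite /separates -leqNgt.
(* Both counts run over the same vertex set, so it is enough that the two relations have the same
   components: a detour replaces [e]. *)
suff cE : connect (adj A) =2 connect (adj (A :\ e)) by rewrite (eq_n_comp cE).
move=> u v; apply/idP/idP; last first.
  by apply: connect_sub => {}u {}v /sA; exact: connect1.
apply: connect_sub => {}u {}v /adjP[[f b] [/= fA <- <-]].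
have [-> {f fA}|fe] := eqVneq f e; last by apply/connect1/adjP; exists (f, b); rewrite !inE fe.
by case: b; rewrite /dsrc /dtgt //= (sym_connect_sym (adj_sym _)).
Qed.

Lemma connect_walk A u v : connect (adj A) u v ->
  exists p, [/\ is_walk u p v, forall d, d \in p -> d.1 \in A &
                uniq (u :: [seq dtgt d | d <- p])].
Proof.
case/connectP => q uq ->; case: (shortenP uq) => {q uq} q uq uniqq _.
suff [p [wp pA pq]] : exists p, [/\ is_walk u p (last u q),
    forall d, d \in p -> d.1 \in A & [seq dtgt d | d <- p] = q].
  by exists p; rewrite pq.
elim: q u uq {uniqq} => [|w q IH] u /=; first by exists [::] => /=; split.
case/andP=> /adjP[d [dA <- <-]] /IH[p [wp pA pq]]; exists (d :: p).
split=> /=; rewrite ?pq ?eqxx //= => d'; rewrite in_cons => /orP[/eqP -> //|]; exact: pA.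
Qed.

Lemma walk_dsrc u p v : is_walk u p v ->
  rcons [seq dsrc d | d <- p] v = u :: [seq dtgt d | d <- p].
Proof. by elim: p u => [|d p IH] u /=; [move/eqP-> | case/andP=> /eqP -> /IH ->]. Qed.

(** A second passage through the first edge would bring the walk back to its starting vertex [u]. *)
Lemma walk_uniq_edges u p v : is_walk u p v -> uniq (u :: [seq dtgt d | d <- p]) ->
  uniq [seq d.1 | d <- p].
Proof.
elim: p u => [|d p IH] u //= /andP[/eqP du wp] /andP[up uniqp].
rewrite (IH _ wp uniqp) andbT; apply/negP => /mapP[d' d'p dd'].
have := walk_dsrc wp => E.
have tp : dtgt d' \in dtgt d :: [seq dtgt d | d <- p] by rewrite in_cons map_f ?orbT.
have sp : dsrc d' \in dtgt d :: [seq dtgt d | d <- p].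
  by rewrite -E mem_rcons in_cons map_f ?orbT.
have : (u == dtgt d') || (u == dsrc d').
  rewrite -du; case: (d) (d') dd' => e b [e' b'] /= <-.
  by case: b; case: b'; rewrite /dsrc /dtgt /= eqxx ?orbT.
by move=> /orP[]/eqP uE; rewrite uE ?tp ?sp in up.
Qed.

Lemma wchain_in p A : (forall d, d \in p -> d.1 \in A) ->
  forall e, e \notin A -> wchain p 0 e = 0.
Proof.
by move=> pA e eA; apply: wchain_off => d /pA dA; apply: contraNneq eA => <-.
Qed.

(* From left to right: the indicator function of the component of [src e] in
   [A :\ e] is a cochain whose coboundary, on [A], is supported on [e]. *)
Lemma cycle_in_connect A e : e \in A ->
  (exists2 z, cycle_in A z & z 0 e != 0) <-> connect (adj (A :\ e)) (src e) (tgt e).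
Proof.
move=> eA; split=> [[z [z0 zA] ze]|].
  apply/negPn/negP => nc; case/negP: ze.
  pose x := \col_(v < nvert G) ((connect (adj (A :\ e)) (src e) v)%:R : rat).
  have : (z *m bdmx G *m x) 0 0 = 0 by rewrite z0 mul0mx mxE.
  rewrite -mulmxA mxE (bigD1 e) //= big1 => [|f fe].
    rewrite addr0 bdmxM !mxE connect0 (negbTE nc) sub0r mulrN1 => /eqP.
    by rewrite oppr_eq0.
  have [fA|/zA ->] := boolP (f \in A); last by rewrite mul0r.
  rewrite bdmxM !mxE; apply/eqP; rewrite mulf_eq0 subr_eq0; apply/orP; right.
  have fAe : adj (A :\ e) (src f) (tgt f) by rewrite adj_edge // !inE fe.
  by rewrite (same_connect_r (sym_connect_sym (adj_sym _)) (connect1 fAe)).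
case/connect_walk => p [wp pA _].
(* The edge [e], run backwards, closes the path; the path avoids [e], so the coefficient at [e] does
   not cancel. *)
pose q := (e, false) :: p.
have wq : is_walk (tgt e) q (tgt e) by rewrite /= eqxx.
exists (wchain q); first split.
- by rewrite (wchain_bd wq) subrr.
- apply: wchain_in => d; rewrite in_cons => /orP[/eqP -> //|/pA].
  by rewrite !inE => /andP[].
rewrite wchain_cons !mxE !eqxx wchain_off /= ?addr0 ?mulr1 //.
by move=> d /pA; rewrite !inE => /andP[].
Qed.

Lemma separatesP A e : e \in A ->
  reflect (exists2 z, cycle_in A z & z 0 e != 0) (~~ separates A e).
Proof.
move=> eA; rewrite separatesE // negbK.
by apply: (iffP idP) => /(cycle_in_connect eA).
Qed.

(** The chain of a loop is nonzero since no edge repeats. Conversely, an edge in the support of a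
    cycle has its ends joined in the rest of [A] by a path without repeated vertices, which that
    edge closes to a loop. *)
Lemma contains_loopP A :
  contains_loop A <-> exists2 z, cycle_in A z & z != 0.
Proof.
split=> [[p [[]]]|[z zA z0]].
  case: p => // d p _ [v wp] /= /andP[dp _] _ pA; exists (wchain (d :: p)).
    by split; [rewrite (wchain_bd wp) subrr | exact: wchain_in].
  apply/eqP => /rowP/(_ d.1); rewrite wchain_cons !mxE !eqxx mulr1 wchain_off ?addr0.
    by move/eqP; apply/negP; exact: dsign_neq0.
  by move=> d' d'p; apply: contraNneq dp => <-; exact: map_f.
have /existsP[e ze] : [exists e, z 0 e != 0].
  apply: contraNT z0; rewrite negb_exists => /forallP z0.
  by apply/eqP/rowP => e; have := z0 e; rewrite negbK mxE => /eqP.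
have eA : e \in A by apply: contraNT ze => /zA.2 ->.
have /(cycle_in_connect eA) : exists2 z, cycle_in A z & z 0 e != 0 by exists z.
case/connect_walk => p [wp pA up].
exists ((e, false) :: p); split; last first.
  by move=> d; rewrite in_cons => /orP[/eqP -> //|/pA]; rewrite !inE => /andP[].
split=> //=.
- by exists (tgt e); rewrite eqxx.
- rewrite (walk_uniq_edges wp up) andbT; apply/mapP => -[d /pA].
  by rewrite !inE => /andP[/eqP de _] /esym.
- by have := walk_dsrc wp => E; rewrite -E rcons_uniq in up.
Qed.

End Connectivity.

Lemma core_cycle (G : graph) (A : {set edge G}) : core A ->
  forall e, e \in A -> exists2 z, cycle_in A z & z 0 e != 0.
Proof. by move=> /forallP cA e eA; apply/separatesP => //; exact: (implyP (cA e)). Qed.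

Lemma coreP (G : graph) (A : {set edge G}) :
  (forall e, e \in A -> exists2 z, cycle_in A z & z 0 e != 0) -> core A.
Proof. by move=> cA; apply/forallP => e; apply/implyP => eA; apply/separatesP/cA. Qed.

(** The witness is the union of the supports of the cycles of [A]. *)
Lemma exists_core (G : graph) (A : {set edge G}) :
  exists B : {set edge G}, [/\ B \subset A, core B &
    forall z, cycle_in A z -> cycle_in B z].
Proof.
pose B := [set e | `[< exists2 z, cycle_in A z & z 0 e != 0 >]]%SET.
have BP z : cycle_in A z -> cycle_in B z.
  move=> zA; split=> [|e]; first by case: zA.
  by rewrite inE; apply: contraNeq => ze; apply/asboolP; exists z.
exists B; split=> //.
  apply/fintype.subsetP => e; rewrite inE => /asboolP[z [_ zA]].
  by apply: contraNT => /zA ->.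
by apply: coreP => e; rewrite inE => /asboolP[z /BP zB ze]; exists z.
Qed.

(** * Collapses *)

Section Collapse.
Variables (G H : graph) (A : {set edge G}) (f : gmap G H) (s : edge H -> edge G).
Hypothesis fs : collapse A f s.

Lemma collapse_edge : exists b : edge H -> bool, forall e', ge f (s e') = [:: (e', b e')].
Proof. by have [_ _ _ _ h] := fs; have [b bE] := choice h; exists b. Qed.

Lemma collapse_inj : injective s.
Proof. by have [_ _ []] := fs. Qed.

Lemma collapse_codom e : e \notin A -> exists e', e = s e'.
Proof.
have [_ _ [_ sA] _ _] := fs; rewrite sA negbK => /codomP[e' ->]; by exists e'.
Qed.

Lemma collapse_notin e' : s e' \notin A.
Proof. by have [_ _ [_ sA] _ _] := fs; rewrite sA negbK codom_f. Qed.

Lemma collapse_nil e : e \in A -> ge f e = [::].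
Proof. by have [_ _ _ fA _] := fs; exact: fA. Qed.

Lemma collapse_mx (b : edge H -> bool) (bE : forall e', ge f (s e') = [:: (e', b e')])
    (z : 'rV[rat]_(nedge G)) e' :
  (z *m gmx f) 0 e' = dsign (b e') * z 0 (s e').
Proof.
rewrite mxE (bigD1 (s e')) //= big1 => [|e es].
  by rewrite addr0 mxE bE wchain_cons wchain_nil addr0 !mxE !eqxx mulr1 mulrC.
rewrite mxE; have [eA|/collapse_codom[e'' eE]] := boolP (e \in A).
  by rewrite collapse_nil // wchain_nil mxE mulr0.
rewrite eE bE wchain_cons wchain_nil addr0 !mxE eqxx /=.
have [E|] := eqVneq e' e''; last by rewrite !mulr0.
by rewrite eE E eqxx in es.
Qed.

Lemma collapse_push B z : cycle_in B z -> cycle_in (s @^-1: B) (z *m gmx f).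
Proof.
move=> [z0 zB]; split; first exact: gmx_cycle.
have [b bE] := collapse_edge => e'; rewrite inE => /zB ze.
by rewrite (collapse_mx bE) ze mulr0.
Qed.

Lemma collapse_mx_neq0 (z : 'rV[rat]_(nedge G)) e' :
  ((z *m gmx f) 0 e' != 0) = (z 0 (s e') != 0).
Proof.
have [b bE] := collapse_edge.
by rewrite (collapse_mx bE) mulf_eq0 (negbTE (dsign_neq0 _)).
Qed.

(** The coefficients of [z'] are placed on the edges outside [A], and the boundary of the resulting
    chain is then cancelled by a chain [a *m P] supported in [A]. *)
Lemma collapse_lift C z' : cycle_in C z' ->
  exists2 z, cycle_in (A :|: s @: C) z & z *m gmx f = z'.
Proof.
move=> [z'0 z'C]; have [b bE] := collapse_edge; have [f_surj fA _ _ _] := fs.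
pose z0 : 'rV[rat]_(nedge G) := \row_e
  (if [pick e' | s e' == e] is Some e' then dsign (b e') * z' 0 e' else 0).
have z0s e' : z0 0 (s e') = dsign (b e') * z' 0 e'.
  rewrite mxE; case: pickP => [e'' /eqP/collapse_inj -> //|/(_ e')].
  by rewrite eqxx.
have z0A e : e \in A -> z0 0 e = 0.
  move=> eA; rewrite mxE; case: pickP => // e' /eqP E.
  by have := collapse_notin e'; rewrite E eA.
have z0f : z0 *m gmx f = z'.
  by apply/rowP => e'; rewrite (collapse_mx bE) z0s mulrA dsignM mul1r.
pose P := diag_mx (\row_e (e \in A)%:R) : 'M[rat]_(nedge G).
have wP (w : 'rV_(nedge G)) e : (w *m P) 0 e = w 0 e * (e \in A)%:R.
  by rewrite mul_mx_diag !mxE.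
(* [z0 *m bdmx G] sums to 0 over the components of [A], hence it bounds in [A]. *)
have /submxP[a aE] : (z0 *m bdmx G <= P *m bdmx G)%MS.
  (* The columns of [K] are functions on the vertices that are constant on the components of [A].
     They are pulled back from [H], so pairing them with the boundary of [z0] only sees the boundary
     of [z']. *)
  rewrite submxE; set K := cokermx _.
  have PK : P *m bdmx G *m K = 0 by exact: mulmx_coker.
  clearbody K.
  have Kedge e j : e \in A -> K (src e) j = K (tgt e) j.
    move=> eA; have : (P *m (bdmx G *m K)) e j = 0 by rewrite mulmxA PK mxE.
    by rewrite mul_diag_mx mxE bdmxM mxE eA mul1r => /eqP; rewrite subr_eq0 => /eqP.
  have Kf u v j : gv f u = gv f v -> K u j = K v j.
    move/fA/connectP => [p up ->]; elim: p u up => //= w p IH u.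
    case/andP=> /adjP[[e c] [/= eA <- <-]] /IH <-.
    by rewrite /dsrc /dtgt /=; case: c; rewrite Kedge.
  have /choice[r rK] := f_surj.
  have -> : K = gvmx f *m \matrix_(w, j) K (r w) j.
    apply/row_matrixP => u; rewrite row_mul rowK -rowE; apply/rowP => j.
    by rewrite !mxE; apply: Kf; rewrite rK.
  by rewrite mulmxA -(mulmxA z0) -gmx_bd mulmxA z0f z'0 mul0mx.
exists (z0 - a *m P); first split.
- by rewrite mulmxBl -mulmxA -aE subrr.
- move=> e; rewrite inE negb_or => /andP[eA eC]; rewrite !mxE.
  have := wP a e; rewrite mxE => ->; rewrite (negbTE eA) mulr0 subr0.
  have [e' eE] := collapse_codom eA; have := z0s e'; rewrite eE mxE => ->.
  by rewrite z'C ?mulr0 //; apply: contra eC => e'C; rewrite eE imset_f.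
rewrite mulmxBl z0f; apply/rowP => e'; rewrite !mxE.
have := collapse_mx bE (a *m P) e'; rewrite mxE => ->.
by rewrite wP (negbTE (collapse_notin e')) !mulr0 subr0.
Qed.

Lemma collapse_core B : core B -> core (s @^-1: B).
Proof.
move=> cB; apply: coreP => e'; rewrite inE => /(core_cycle cB)[z zB ze].
by exists (z *m gmx f); [exact: collapse_push | rewrite collapse_mx_neq0].
Qed.

Lemma collapse_rank_lift (C : {set edge H}) : (rankH1 C <= rankH1 (A :|: s @: C))%N.
Proof.
rewrite !rankH1E; apply: leq_trans (mxrankM_maxl _ (gmx f)); apply/mxrankS/row_subP => i.
have /cyclemxP/collapse_lift[z /cyclemxP zC <-] : (row i (cyclemx C) <= cyclemx C)%MS.
  exact: row_sub.
exact: submxMr.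
Qed.

Lemma collapse_preim (C : {set edge H}) : s @^-1: (A :|: s @: C) = C.
Proof.
apply/setP => e'; rewrite !inE (negbTE (collapse_notin e')) /=.
by rewrite mem_imset //; exact: collapse_inj.
Qed.

Lemma collapse_ends e' : exists b,
  gv f (src (s e')) = dsrc (e', b) /\ gv f (tgt (s e')) = dtgt (e', b).
Proof.
have [b bE] := collapse_edge; exists (b e'); have := geP f (s e').
by rewrite bE /= => /andP[/eqP <- /eqP <-].
Qed.

Lemma collapse_end_eq e : e \in A -> gv f (src e) = gv f (tgt e).
Proof. by move=> eA; have := geP f e; rewrite collapse_nil // => /eqP. Qed.

Lemma collapse_connect B u v :
  connect (adj B) u v -> connect (adj (s @^-1: B)) (gv f u) (gv f v).
Proof.
case/connectP => p up ->; elim: p u up => //= w p IH u.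
case/andP=> /adjP[[e c] [/= eB <- <-]] /IH; apply: connect_trans.
have sym := sym_connect_sym (adj_sym (s @^-1: B)).
suff : connect (adj (s @^-1: B)) (gv f (src e)) (gv f (tgt e)).
  by case: c; rewrite /dsrc /dtgt //= sym.
have [eA|/collapse_codom[e' eE]] := boolP (e \in A).
  by rewrite collapse_end_eq.
have [b] := collapse_ends e'; rewrite -eE => -[-> ->].
by apply/connect1/adjP; exists (e', b); rewrite inE -eE.
Qed.

Lemma collapse_connect_lift C u v :
  connect (adj C) (gv f u) (gv f v) -> connect (adj (A :|: s @: C)) u v.
Proof.
have [f_surj fA _ _ _] := fs; set B := A :|: _.
have AB w w' : gv f w = gv f w' -> connect (adj B) w w'.
  by move/fA; apply: connect_sub => {}w {}w' ww';
    apply: connect1; apply: (adjS _ ww'); exact: finset.subsetUl.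
case/connectP => p; move Ew: (gv f u) => w wp.
elim: p u w Ew wp => [|w' p IH] u w <- /=; first by move=> _ /esym; exact: AB.
case/andP=> /adjP[[e' c] [/= e'C de w'E]] wp vE.
have [u' u'E] := f_surj w'; apply: connect_trans (IH u' w' u'E wp vE).
have [b [bs bt]] := collapse_ends e'.
have sB : connect (adj B) (src (s e')) (tgt (s e')).
  by apply/connect1/adj_edge; rewrite inE imset_f ?orbT.
have [[/AB su /AB tu']|[/AB tu /AB su']] :
    (gv f u = gv f (src (s e')) /\ gv f (tgt (s e')) = gv f u') \/
    (gv f u = gv f (tgt (s e')) /\ gv f (src (s e')) = gv f u').
  rewrite -de u'E -w'E bs bt /dsrc /dtgt /=.
  by case: (c) (b) => -[]; [left | right | right | left].
- exact: connect_trans su (connect_trans sB tu').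
apply: connect_trans tu (connect_trans _ su').
by rewrite (sym_connect_sym (adj_sym _)).
Qed.

End Collapse.

Lemma collapse_comp (G H K : graph) (A : {set edge G}) (B : {set edge H})
    (f : gmap G H) (s : edge H -> edge G) (h : gmap H K) (t : edge K -> edge H) :
  collapse A f s -> collapse B h t -> collapse (A :|: s @: B) (gcomp h f) (s \o t).
Proof.
move=> fs ht; have [f_surj _ _ _ _] := fs; have [h_surj hB _ _ _] := ht.
split.
- by move=> w; have [v <-] := h_surj w; have [u <-] := f_surj v; exists u.
- move=> u v /=; rewrite hB; split; first exact: collapse_connect_lift.
  by move/(collapse_connect fs); rewrite (collapse_preim fs).
- split; first exact: inj_comp (collapse_inj fs) (collapse_inj ht).
  move=> e; rewrite inE; have [eA|/(collapse_codom fs)[e' ->]] := boolP (e \in A).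
    by symmetry; apply/codomP => -[e' E]; have := collapse_notin fs (t e'); rewrite -[s (t e')]E eA.
  rewrite /= mem_imset; last exact: collapse_inj fs.
  have [_ _ [_ ->] _ _] := ht; congr (~~ _).
  by apply/codomP/codomP => -[e'' E]; exists e'';
    [rewrite E | apply: (collapse_inj fs)].
- move=> e; rewrite inE /= => /orP[/(collapse_nil fs) -> //|/imsetP[e' e'B ->]].
  have [b ->] := collapse_edge fs; rewrite gw1 /gd /= (collapse_nil ht) //.
  by case: (b e').
- move=> e /=; have [b ->] := collapse_edge fs; have [c cE] := collapse_edge ht.
  rewrite gw1 /gd /=; case: (b _); rewrite cE; first by exists (c e).
  by exists (~~ c e).
Qed.

Lemma isometry_collapse (R : realType) (G H : graph) (f : gmap G H)
    (s : edge H -> edge G) (x : 'rV[R]_(nedge G)) (y : 'rV[R]_(nedge H)) :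
  Defs.isometry f s x y -> collapse finset.set0 f s.
Proof.
case=> -[k fK kK] [t sK tK] fs _; split=> //.
- by move=> w; exists (k w).
- move=> u v; split=> [uv|/connectP[[|w p] /= up ->] //].
    by rewrite -(fK u) -(fK v) uv connect0.
  by case/andP: up => /adjP[d []]; rewrite inE.
- split=> [|e]; first exact: can_inj sK.
  by rewrite inE -(tK e) codom_f.
- by move=> e; rewrite inE.
Qed.

Lemma cycle_in0 (G : graph) (z : 'rV[rat]_(nedge G)) :
  cycle_in finset.set0 z -> z = 0.
Proof. by case=> _ z0; apply/rowP => e; rewrite z0 ?inE // mxE. Qed.

(** * Collapsing forests *)

Section ForestCollapse.
Variables (G H : graph) (A : {set edge G}) (f : gmap G H) (s : edge H -> edge G).
Hypotheses (fs : collapse A f s) (A0 : forall z, cycle_in A z -> z = 0).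

(** A cycle killed by the collapse is supported in [A], where only 0 is a cycle. *)
Lemma forest_collapse_inj B z : cycle_in B z -> z *m gmx f = 0 -> z = 0.
Proof.
move=> [z0 _] zf; apply: A0; split=> // e /(collapse_codom fs)[e' ->].
by apply/eqP; rewrite -[_ == _]negbK -(collapse_mx_neq0 fs) zf mxE eqxx.
Qed.

Lemma forest_collapse_rank B : (rankH1 B <= rankH1 (s @^-1: B))%N.
Proof.
apply: (leq_rankH1 (L := gmx f)) => z; first exact: (collapse_push fs).
exact: forest_collapse_inj.
Qed.

Lemma forest_collapse_preim0 B : core B -> B != finset.set0 -> s @^-1: B != finset.set0.
Proof.
move=> cB /set0Pn[e0 e0B]; have [z zB ze] := core_cycle cB e0B.
have /set0Pn[e]: [set e | (z *m gmx f) 0 e != 0]%SET != finset.set0.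
  apply: contraNneq ze => /setP E; rewrite (forest_collapse_inj zB) ?mxE //.
  by apply/rowP => e; have := E e; rewrite !inE => /negbFE/eqP ->; rewrite mxE.
rewrite inE => ze'; apply/set0Pn; exists e.
by apply: contraNT ze' => eB; apply/eqP/(collapse_push fs zB).2.
Qed.

End ForestCollapse.

Lemma collapse_sum (V : nmodType) (G H : graph) (A B : {set edge G}) (f : gmap G H)
    (s : edge H -> edge G) (x : edge G -> V) :
  collapse A f s -> (forall e, e \in A -> x e = 0) ->
  \sum_(e in B) x e = \sum_(e' in s @^-1: B) x (s e').
Proof.
move=> fs xA; rewrite -(big_imset _ (in2W (collapse_inj fs))) /=.
rewrite (bigID [in A]) /= big1 ?add0r => [|e /andP[_ /xA] //].
apply: eq_bigl => e; apply/andP/imsetP => [[eB /(collapse_codom fs)[e' eE]]|[e']].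
  by exists e'; rewrite // inE -eE.
by rewrite inE => sB ->; rewrite sB (collapse_notin fs).
Qed.

Lemma collapse_outer_connected (G H : graph) (A : {set edge G}) (f : gmap G H)
    (s : edge H -> edge G) :
  collapse A f s -> (forall u v : vert G, connect (adj [set: edge G]) u v) ->
  forall u v : vert H, connect (adj [set: edge H]) u v.
Proof.
move=> fs cG u v; have [f_surj _ _ _ _] := fs.
have [u' <-] := f_surj u; have [v' <-] := f_surj v.
by have := collapse_connect fs (cG u' v'); rewrite preimsetT.
Qed.

Lemma collapse_nonseparating (G H : graph) (A : {set edge G}) (f : gmap G H)
    (s : edge H -> edge G) :
  collapse A f s -> (forall e : edge G, ~~ separates [set: edge G] e) ->
  forall e : edge H, ~~ separates [set: edge H] e.
Proof.
move=> fs nG e; apply/separatesP; first by rewrite inE.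
have /separatesP[|z zG ze] := nG (s e); first by rewrite inE.
exists (z *m gmx f); last by rewrite (collapse_mx_neq0 fs).
by have := collapse_push fs zG; rewrite preimsetT.
Qed.

(** * Collapsing a single edge that is not a loop *)

Section EdgeCollapse.
Variables (G : graph) (e : edge G).
Hypothesis ne : tgt e != src e.

(** The vertices of the quotient are those of [G] other than [tgt e], renumbered; the default value,
    reached only at [tgt e], is the new number of [src e]. *)
Definition ecv (w : vert G) : 'I_(nvert G).-1 :=
  odflt (s2val (unlift_some ne)) (unlift (tgt e) w).

Lemma ecv_lift (j : 'I_(nvert G).-1) : ecv (lift (tgt e) j) = j.
Proof. by rewrite /ecv liftK. Qed.

Lemma ecv_tgt : ecv (tgt e) = ecv (src e).
Proof.
rewrite {1}/ecv unlift_none /=; case: unlift_some => j /= E _.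
by rewrite {}E ecv_lift.
Qed.

Lemma lift_ecv w : w != tgt e -> lift (tgt e) (ecv w) = w.
Proof. by rewrite eq_sym => /unlift_some[j -> _]; rewrite ecv_lift. Qed.

Lemma ecv_inj w w' : ecv w = ecv w' -> w != tgt e -> w' != tgt e -> w = w'.
Proof. by move=> E wt wt'; rewrite -(lift_ecv wt) E lift_ecv. Qed.

Definition ecgraph : graph := Graph
  (fun j : 'I_(nedge G).-1 => ecv (src (lift e j))) (fun j => ecv (tgt (lift e j))).

Definition ecpath (e' : edge G) : seq (dart ecgraph) :=
  if unlift e e' is Some j then [:: (j, true)] else [::].

Lemma ecpathP e' : @is_walk ecgraph (ecv (src e')) (ecpath e') (ecv (tgt e')).
Proof.
rewrite /ecpath; case: unliftP => [j ->|->] /=; first by rewrite !eqxx.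
by rewrite ecv_tgt.
Qed.

Definition ecmap : gmap G ecgraph := @GMap G ecgraph ecv ecpath ecpathP.

Lemma ecmap_collapse : collapse [set e] ecmap (lift e : edge ecgraph -> edge G).
Proof.
have cte : connect (adj [set e]) (src e) (tgt e).
  by apply/connect1/adj_edge; rewrite inE.
have sym := sym_connect_sym (adj_sym [set e]).
split.
- by move=> j; exists (lift (tgt e) j); exact: ecv_lift.
- move=> u v; split=> /= [|/connectP[p up ->]].
    have [->|ut] := eqVneq u (tgt e); have [->|vt] := eqVneq v (tgt e) => //.
    + rewrite ecv_tgt => /ecv_inj <- //; first by rewrite sym.
      by rewrite eq_sym.
    + by rewrite ecv_tgt => /ecv_inj -> //; rewrite eq_sym.
    + by move/ecv_inj => ->.
  elim: p u up => //= w p IH u /andP[/adjP[[f b] [/= /set1P -> <- <-]] /IH <-].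
  by case: b; rewrite /dsrc /dtgt /= ecv_tgt.
- split=> [|e']; first exact: lift_inj.
  rewrite inE; case: (unliftP e e') => [j ->|->].
    by rewrite eq_sym (negbTE (neq_lift _ _)) codom_f.
  by rewrite eqxx; symmetry; apply/codomP => -[j /eqP]; rewrite (negbTE (neq_lift _ _)).
- by move=> e' /set1P ->; rewrite /= /ecpath unlift_none.
- by move=> j; exists true; rewrite /= /ecpath liftK.
Qed.

(** A path to [w] from the vertex representing its class. It is both the track of the homotopy from
    [ecinv] after [ecmap] to the identity and the correction making [ecinv] continuous at the ends
    of edges. *)
Definition ectrack (w : vert G) : seq (dart G) :=
  if w == tgt e then [:: (e, true)] else [::].

Lemma ectrackP w : is_walk (lift (tgt e) (ecv w)) (ectrack w) w.
Proof.
rewrite /ectrack; have [->|wt] := eqVneq w (tgt e); last by rewrite /= lift_ecv.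
by rewrite ecv_tgt lift_ecv 1?eq_sym // /= !eqxx.
Qed.

Lemma gw_ectrack w : gw ecmap (ectrack w) = [::].
Proof. by rewrite /ectrack; case: ifP => // _; rewrite gw1 /gd /= /ecpath unlift_none. Qed.

Definition ecinv_path (j : edge ecgraph) : seq (dart G) :=
  ectrack (src (lift e j)) ++ (lift e j, true) :: wrev (ectrack (tgt (lift e j))).

Lemma ecinv_pathP j :
  is_walk (lift (tgt e) (@src ecgraph j)) (ecinv_path j) (lift (tgt e) (@tgt ecgraph j)).
Proof.
apply: is_walk_cat (ectrackP _) _; rewrite /= eqxx /=.
exact/is_walk_wrev/ectrackP.
Qed.

Definition ecinv : gmap ecgraph G := @GMap ecgraph G (lift (tgt e)) ecinv_path ecinv_pathP.

Lemma ecmap_he : homotopy_equiv ecmap.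
Proof.
exists ecinv; split.
  exists ectrack; split=> [w|e']; first exact: ectrackP.
  rewrite /= /ecpath; case: unliftP => [j ->|->].
    rewrite gw1 /gd /= /ecinv_path -catA; apply: whtpy_catl.
    rewrite -cat1s -catA; apply: whtpy_catl => /=.
    exact: whtpy_wrevl.
  rewrite /ectrack eqxx eq_sym (negbTE ne) /=; exact: whtpy_refl.
apply: homotopic_eq => [j|j] /=; first exact: ecv_lift.
rewrite gw_cat gw_cons gw_wrev !gw_ectrack /gd /= /ecpath liftK.
by [].
Qed.

Lemma valence_ec w : valence (ecv w : vert ecgraph) =
  #|[set d : dart G | (d.1 != e) && (ecv (dsrc d) == ecv w)]|.
Proof.
pose l (d : dart ecgraph) : dart G := (lift e d.1, d.2).
have linj : injective l by move=> [j b] [k c] E; have /lift_inj /= -> := congr1 fst E;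
    have /= -> := congr1 snd E.
rewrite /valence -(card_imset _ linj); apply: eq_card => -[e' b]; rewrite inE /=.
apply/imsetP/andP => [[[j c]]|[e'e /eqP dE]].
  rewrite inE => /eqP dE [-> ->]; rewrite eq_sym neq_lift; split=> //.
  by apply/eqP; rewrite -dE; case: (c).
move: e'e dE; rewrite eq_sym => /unlift_some[j -> _] dE.
by exists (j, b) => //; rewrite inE -dE; apply/eqP; case: (b).
Qed.

(** Vertices away from [e] keep their darts. Both ends of [e] carry a dart, so their valence is at
    least 3, and the merged vertex, which loses the two darts of [e], has valence at least 3 + 3 -
    2. *)
Lemma ecgraph_valence (w : vert G) : (forall v : vert G, valence v != 1 /\ valence v != 2) ->
  valence (ecv w : vert ecgraph) != 1 /\ valence (ecv w : vert ecgraph) != 2.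
Proof.
move=> val.
wlog wt : w / w != tgt e => [th|].
  have [->|wt] := eqVneq w (tgt e); last exact: th.
  by rewrite ecv_tgt; apply: th; rewrite eq_sym.
rewrite valence_ec; have [->|ws] := eqVneq w (src e); last first.
  suff -> : [set d : dart G | (d.1 != e) && (ecv (dsrc d) == ecv w)] =
            [set d : dart G | dsrc d == w] by exact: val.
  apply/setP => d; rewrite !inE; apply/andP/eqP => [[_ /eqP E]|E].
    have [dt|dt] := eqVneq (dsrc d) (tgt e); last exact: ecv_inj E dt wt.
    by rewrite dt ecv_tgt in E; rewrite -(ecv_inj E _ wt) ?eqxx 1?eq_sym in ws.
  split; last by rewrite E.
  case: d E => e' b /= E; apply/eqP => e'e; move: E wt ws; rewrite e'e /dsrc /=.
  by case: b => <-; rewrite eqxx.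
pose D u : {set dart G} := [set d | dsrc d == u]; pose N := [set (e, true); (e, false)].
have -> : [set d : dart G | (d.1 != e) && (ecv (dsrc d) == ecv (src e))] =
    (D (src e) :|: D (tgt e)) :\: N.
  apply/setP => d; rewrite !inE; congr (_ && _).
    by case: d => e' b; rewrite !xpair_eqE /=; case: (e' == e); case: b.
  apply/idP/orP => [/eqP|[]/eqP ->]; rewrite ?ecv_tgt // => E.
  have [dt|dt] := eqVneq (dsrc d) (tgt e); first by right.
  by left; apply/eqP/ecv_inj => //; rewrite eq_sym.
have DD : D (src e) :&: D (tgt e) = finset.set0.
  apply/setP => d; rewrite !inE; apply/andP => -[/eqP -> /eqP E].
  by move: ne; rewrite E eqxx.
have ND : N \subset D (src e) :|: D (tgt e).
  by apply/fintype.subsetP => d; rewrite !inE => /orP[]/eqP ->; rewrite eqxx ?orbT.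
have N2 : #|N| = 2%N by rewrite cards2 xpair_eqE andbF.
rewrite cardsD (finset.setIidPr ND) cardsU DD cards0 subn0 N2.
have gt0 u d : d \in D u -> (2 < #|D u|)%N.
  move=> du; have [/eqP n1 /eqP n2] := val u.
  have : (0 < #|D u|)%N by apply/card_gt0P; exists d.
  by move: n1 n2; rewrite /valence -/(D u); case: #|D u| => [|[|[|]]].
have s3 := gt0 (src e) (e, true); have t3 := gt0 (tgt e) (e, false).
rewrite !inE !eqxx in s3 t3; have := leq_add (s3 isT) (t3 isT).
by case: (#|D (src e)| + #|D (tgt e)|)%N => [|[|[|[|[|]]]]].
Qed.

Lemma ecgraph_outer : outer_graph G -> outer_graph ecgraph.
Proof.
case=> cG vG nG; split; first exact: collapse_outer_connected ecmap_collapse cG.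
  by move=> j; rewrite -(ecv_lift j); exact: ecgraph_valence.
exact: collapse_nonseparating ecmap_collapse nG.
Qed.

End EdgeCollapse.

Definition mcollapse (n : nat) (M : marked n) (e : edge M) (ne : tgt e != src e) : marked n :=
  Marked (ecgraph_outer ne (mgraph_outer M))
    (homotopy_equiv_comp (marking_he M) (ecmap_he ne)).

Lemma collapse_gid (G : graph) : collapse finset.set0 (gid G) id.
Proof.
split=> //.
- by move=> w; exists w.
- move=> u v; split=> /= [-> //|/connectP[[|w p] /= up ->] //].
  by case/andP: up => /adjP[d []]; rewrite inE.
- by split=> // e; rewrite inE; symmetry; apply/negbTE; rewrite negbK; apply/codomP; exists e.
- by move=> e; rewrite inE.
- by move=> e; exists true.
Qed.

(** * Points of Outer space given by simplices with missing faces *)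

Section Realize.
Variables (R : realType) (n : nat).

Lemma in_zero_edges (G : graph) (x : 'rV[R]_(nedge G)) e :
  (e \in zero_edges x) = (x 0 e == 0).
Proof. by rewrite inE. Qed.

Lemma bar_simplex_cycle (G : graph) (x : 'rV[R]_(nedge G)) : bar_simplex x ->
  forall z, cycle_in (zero_edges x) z -> z = 0.
Proof.
move=> [_ nl] z zx; apply/eqP; apply: contra_notT nl => z0.
by apply/contains_loopP; exists z.
Qed.

Lemma open_simplex_zero (G : graph) (x : 'rV[R]_(nedge G)) :
  open_simplex x -> zero_edges x = finset.set0.
Proof. by case=> x0 _; apply/setP => e; rewrite !inE gt_eqF. Qed.

Lemma open_bar_simplex (G : graph) (x : 'rV[R]_(nedge G)) :
  open_simplex x -> bar_simplex x.
Proof.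
move=> xo; split.
  by case: xo => x0 x1; split=> // e; exact: ltW.
move/contains_loopP; rewrite (open_simplex_zero xo) => -[z /cycle_in0 ->].
by rewrite eqxx.
Qed.

Lemma realizes_self (X : metric_marked R n) : realizes (mlen X) (opoint X).
Proof.
split; first exact: open_bar_simplex (mlenP X).
exists X; split=> //; exists (gid X), id; split=> //; last exact: gcomp1g.
by rewrite (open_simplex_zero (mlenP X)); exact: collapse_gid.
Qed.

(** Induction on the number of edges of length 0, collapsing one at a time: such an edge is not a
    loop, and a cycle among the zero edges of the quotient would lift to one among those of [x]. *)
Lemma realizable (M : marked n) (x : 'rV[R]_(nedge M)) :
  bar_simplex x -> exists p, realizes x p.
Proof.
move: {2}#|_| (leqnn #|zero_edges x|) => k; elim: k M x => [|k IH] M x.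
  rewrite leqn0 cards_eq0 => /eqP x0 [[xge x1] _].
  have xo : open_simplex x.
    split=> // e; rewrite lt_neqAle xge andbT eq_sym.
    by rewrite -in_zero_edges x0 inE.
  by exists (opoint (MetricMarked xo)); exact: (realizes_self (MetricMarked xo)).
move=> xk xb; have [/eqP|/set0Pn[e ex]] := boolP (zero_edges x == finset.set0).
  by move=> x0; apply: IH => //; rewrite x0 cards0.
have ne : tgt e != src e.
  apply/eqP => te; have [_ []] := xb; exists [:: (e, true)]; split.
    by split=> //; exists (src e); rewrite /= /dsrc /dtgt /= te !eqxx.
  by move=> d; rewrite inE => /eqP ->.
pose M1 := mcollapse ne; have fs := ecmap_collapse ne.
pose s : edge M1 -> edge M := lift e.
pose x1 : 'rV[R]_(nedge M1) := \row_j x 0 (s j).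
have zx1 : zero_edges x1 = s @^-1: zero_edges x.
  by apply/setP => j; rewrite !inE mxE.
have ezx : zero_edges x = [set e] :|: s @: zero_edges x1.
  apply/setP => f; rewrite finset.in_setU finset.in_set1.
  have [->|fe] := eqVneq f e; first by rewrite ex.
  have [|j ->] := collapse_codom fs (e := f); first by rewrite inE.
  by rewrite /= mem_imset ?zx1 ?inE //; exact: lift_inj.
have x1b : bar_simplex x1.
  have [[xge xsum] _] := xb; split; first split.
  - by move=> j; rewrite mxE.
  - rewrite -xsum; transitivity (\sum_(j in s @^-1: [set: edge M]) x 0 (s j)).
      by apply: eq_big => j; rewrite ?inE ?mxE.
    rewrite -(collapse_sum _ fs (x := x 0)); first by apply: eq_bigl => f; rewrite inE.
    by move=> f /set1P ->; apply/eqP; rewrite -in_zero_edges.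
  move/contains_loopP => [z' z'1 z'0].
  have [z zx zE] := collapse_lift fs z'1; rewrite -ezx in zx.
  by move: z'0; rewrite -zE (bar_simplex_cycle xb zx) mul0mx eqxx.
have [p [_ [Y [_ [h [t [ht yt hY]]]]]]] : exists p, realizes x1 p.
  apply: IH x1b; rewrite -ltnS; apply: leq_trans xk.
  rewrite ezx cardsU1 card_imset; last exact: lift_inj.
  rewrite (_ : e \notin _) //; apply/imsetP => -[j _ /eqP].
  by rewrite (negbTE (neq_lift _ _)).
exists (opoint Y); split=> //; exists Y; split=> //.
exists (gcomp h (ecmap ne)), (s \o t); split.
- by rewrite ezx; exact: collapse_comp fs ht.
- by move=> e'; rewrite yt mxE.
- by apply: homotopic_trans (gcompA _ _ _) hY.
Qed.

End Realize.

(** * Finiteness of combinatorial types *)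

Section Bounds.
Variable G : graph.
Local Open Scope nat_scope.

Lemma sum_valence : \sum_(v : vert G) valence v = 2 * nedge G.
Proof.
have -> : 2 * nedge G = #|{: dart G}| by rewrite card_prod card_bool card_ord mulnC.
rewrite -sum1_card (partition_big (@dsrc G) predT) //=.
by apply: eq_bigr => v _; rewrite /valence -sum1_card; apply: eq_bigl => d; rewrite inE.
Qed.

Lemma nedge_rank : nedge G <= rankH1 [set: edge G] + nvert G.
Proof.
have := rank_leq_col (boundary [set: edge G]); have := mxrank_ker (boundary [set: edge G]).
by rewrite -/(rankH1 _); have := cardsT (edge G); rewrite card_ord; lia.
Qed.

(** If some vertex has valence 0, it is the only one by connectedness, and the summand 3 covers this
    case. Otherwise all valences are at least 3. *)
Lemma nvert_nedge : outer_graph G -> 3 * nvert G <= 2 * nedge G + 3.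
Proof.
case=> cG vG _.
have [/existsP[v /eqP v0]|] := boolP [exists v : vert G, valence v == 0].
  have noadj w : ~~ adj [set: edge G] v w.
    apply/adjP => -[d [_ dv _]]; have := cards0_eq v0 => /setP/(_ d).
    by rewrite !inE dv eqxx.
  have vE w : w = v.
    have /connectP[[|u p] /= vp ->] // := cG v w.
    by case/andP: vp => /(negP (noadj _)).
  have : #|{: vert G}| <= 1 by apply/fintype_le1P => x y; rewrite (vE x) (vE y).
  by rewrite card_ord; lia.
rewrite negb_exists => /forallP v0; apply: leq_trans (leq_addr _ _).
have -> : 3 * nvert G = \sum_(v : vert G) 3 by rewrite sum_nat_const card_ord mulnC.
rewrite -sum_valence leq_sum // => v _.
by have [] := vG v; have := v0 v; case: (valence v) => [|[|[|]]].
Qed.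

End Bounds.

Section MarkedBounds.
Variables (n : nat) (M : marked n).
Local Open Scope nat_scope.

Lemma marked_rank (B : {set edge M}) : rankH1 B <= n.
Proof. exact: rankH1_homotopy_equiv (marking_he M). Qed.

(** With [E] edges and [V] vertices, [E <= n + V] and [3 V <= 2 E + 3] together give
    [E <= 3 n + 3]. *)
Lemma marked_nedge : nedge M <= 3 * n.+1.
Proof.
have := nvert_nedge (mgraph_outer M).
have := leq_trans (nedge_rank M) (leq_add (marked_rank [set: edge M]%SET) (leqnn _)).
by lia.
Qed.

Lemma marked_nvert : nvert M <= 3 * n.+1.
Proof. by have := nvert_nedge (mgraph_outer M); have := marked_nedge; lia. Qed.

End MarkedBounds.

(** * The retraction onto the jewel of a simplex *)

Section JewelRetraction.
Variables (R : realType) (n : nat) (c : nat -> R) (eps : R).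
Hypotheses (c1 : 0 < c 1%N) (cS : forall r, (1 <= r < n)%N -> c r < c r.+1).
Hypotheses (eps0 : 0 < eps) (ceps : c n < eps) (epsn : (3 * n.+1)%:R * eps <= 2^-1).

Lemma c_le r s : (1 <= r)%N -> (r <= s)%N -> (s <= n)%N -> c r <= c s.
Proof.
move=> r1; elim: s => [|s IH]; first by rewrite leqn0 => /eqP ->.
rewrite leq_eqVlt => /orP[/eqP -> //|rs sn]; apply: le_trans (IH rs (ltnW sn)) _.
by apply/ltW/cS; rewrite sn (leq_trans r1 rs).
Qed.

Lemma c_gt0 r : (1 <= r <= n)%N -> 0 < c r.
Proof. by case/andP=> r1 rn; apply: lt_le_trans c1 _; exact: c_le. Qed.

Lemma c_lt_eps r : (1 <= r <= n)%N -> c r < eps.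
Proof. by case/andP=> r1 rn; apply: le_lt_trans ceps; exact: c_le. Qed.

Section Graph.
Variable G : graph.
Implicit Types (x : 'rV[R]_(nedge G)) (A : {set edge G}).

Definition gap x : R :=
  \big[Num.min/1]_(A : {set edge G} | (A != finset.set0) && core A)
    ((\sum_(e in A) x 0 e) / c (rankH1 A)).

Definition low x e : R := Num.min (x 0 e) (gap x * eps).
Definition lowsum x : R := \sum_e low x e.
Definition slope x : R := (gap x - lowsum x) / (1 - lowsum x).

(* The short edges, those of length at most [gap x * eps], keep their length, and
   the excess of the others is scaled so that the total length becomes [gap x];
   then everything is scaled back to total length 1. *)
Definition jretr x : 'rV[R]_(nedge G) :=
  \row_e ((low x e + slope x * (x 0 e - low x e)) / gap x).

Definition jhtpy (t : R) x : 'rV[R]_(nedge G) := (1 - t) *: x + t *: jretr x.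

Lemma jhtpyE t x e : jhtpy t x 0 e =
  (1 - t) * x 0 e + t * ((low x e + slope x * (x 0 e - low x e)) / gap x).
Proof. by rewrite !mxE. Qed.

Lemma jhtpy_jretr t x e : jhtpy t x 0 e = (1 - t) * x 0 e + t * jretr x 0 e.
Proof. by rewrite !mxE. Qed.

Lemma jhtpy0 x : jhtpy 0 x = x.
Proof. by rewrite /jhtpy subr0 scale1r scale0r addr0. Qed.

Lemma jhtpy1 x : jhtpy 1 x = jretr x.
Proof. by rewrite /jhtpy subrr scale0r scale1r add0r. Qed.

Lemma gap_le1 x : gap x <= 1.
Proof. exact: bigmin_le_id. Qed.

Hypotheses (rG : forall A, (rankH1 A <= n)%N) (eG : (nedge G <= 3 * n.+1)%N).

Lemma core_rank A : A != finset.set0 -> core A -> (1 <= rankH1 A <= n)%N.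
Proof.
move=> /set0Pn[e eA] cA; rewrite rG andbT.
have [z zA ze] := core_cycle cA eA; apply: rankH1_gt0 zA _.
by apply: contraNneq ze => ->; rewrite mxE.
Qed.

Lemma gap_core x A : A != finset.set0 -> core A ->
  gap x * c (rankH1 A) <= \sum_(e in A) x 0 e.
Proof.
move=> A0 cA; rewrite -ler_pdivlMr; last exact/c_gt0/core_rank.
by apply: bigmin_le_cond; rewrite A0.
Qed.

Lemma gap_jewel x : jewel c x <-> simplex x /\ gap x = 1.
Proof.
split=> [[xs xj]|[xs x1]]; split=> //; last first.
  by move=> A A0 cA; have := gap_core x A0 cA; rewrite x1 mul1r.
apply: bigmin_eq_id => A /andP[A0 cA]; rewrite ler_pdivlMr ?mul1r; first exact: xj.
exact/c_gt0/core_rank.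
Qed.

(** A nonempty core subgraph carries a nonzero cycle, whereas the edges of length 0 carry none. *)
Lemma core_sum_gt0 x A : bar_simplex x -> A != finset.set0 -> core A ->
  0 < \sum_(e in A) x 0 e.
Proof.
move=> xb /set0Pn[e eA] cA; have [z zA ze] := core_cycle cA eA.
have [/existsP[f /andP[fA xf]]|nf] := boolP [exists f in A, x 0 f != 0].
  have xge g : 0 <= x 0 g by case: xb => -[].
  rewrite (bigD1 f) //=; apply: ltr_wpDr; first by apply: sumr_ge0.
  by rewrite lt_neqAle eq_sym xf xge.
case/negP: ze; rewrite (bar_simplex_cycle xb (z := z)) ?mxE //.
apply: cycle_inS zA; apply/fintype.subsetP => f fA; rewrite inE.
by apply: contraNT nf => xf; apply/existsP; exists f; rewrite fA.
Qed.

Lemma gap_gt0 x : bar_simplex x -> 0 < gap x.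
Proof.
move=> xb; apply/bigmin_gtP; split=> // A /andP[A0 cA].
by apply: divr_gt0; [exact: core_sum_gt0 | exact/c_gt0/core_rank].
Qed.

Section Point.
Variable x : 'rV[R]_(nedge G).
Hypothesis xb : bar_simplex x.

Let xge e : 0 <= x 0 e.
Proof. by case: xb => -[]. Qed.

Let xsum : \sum_e x 0 e = 1.
Proof. by case: xb => -[]. Qed.

Let g0 := gap_gt0 xb.

Lemma low_le e : low x e <= x 0 e.
Proof. by rewrite /low ge_min lexx. Qed.

Lemma low_ge0 e : 0 <= low x e.
Proof. by rewrite /low le_min xge /= mulr_ge0 // ltW. Qed.

(** Each of the at most [3 n + 3] edges contributes at most [gap x * eps]. Hence [lowsum x] is less
    than both [gap x] and 1, which makes [slope x] nonnegative with a positive denominator. *)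
Lemma lowsum_le : lowsum x <= gap x * 2^-1.
Proof.
have : lowsum x <= \sum_(e < nedge G) gap x * eps.
  by apply: ler_sum => e _; rewrite /low ge_min lexx orbT.
move/le_trans; apply; rewrite sumr_const card_ord -mulrnAr ler_pM2l //.
by apply: le_trans epsn; rewrite -mulr_natl ler_pM2r // ler_nat.
Qed.

Lemma lowsum_lt1 : 0 < 1 - lowsum x.
Proof. have l := lowsum_le; have g := gap_le1 x; lra. Qed.

Lemma slope_ge0 : 0 <= slope x.
Proof.
apply: divr_ge0; [have l := lowsum_le; have g := g0; lra | exact/ltW/lowsum_lt1].
Qed.

Lemma jretr_excess_ge0 e : 0 <= slope x * (x 0 e - low x e).
Proof. by rewrite mulr_ge0 ?slope_ge0 // subr_ge0 low_le. Qed.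

Lemma jretr_ge0 e : 0 <= jretr x 0 e.
Proof. by rewrite mxE divr_ge0 ?(ltW g0) // addr_ge0 ?low_ge0 ?jretr_excess_ge0. Qed.

Lemma jretr_eq0 e : x 0 e = 0 -> jretr x 0 e = 0.
Proof.
move=> xe; have := low_ge0 e; have := low_le e; rewrite mxE xe => l0 l1.
have -> : low x e = 0 by apply/eqP; rewrite eq_le l0.
by rewrite subr0 mulr0 addr0 mul0r.
Qed.

Lemma jretr_gt0 e : 0 < x 0 e -> 0 < jretr x 0 e.
Proof.
move=> xe; rewrite mxE divr_gt0 // ltr_pwDl ?jretr_excess_ge0 //.
by rewrite /low lt_min xe mulr_gt0.
Qed.

Lemma jretr_sum : \sum_e jretr x 0 e = 1.
Proof.
under eq_bigr do rewrite mxE.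
rewrite -mulr_suml big_split /= -mulr_sumr sumrB xsum -/(lowsum x) /slope.
by rewrite mulfVK ?gt_eqF ?lowsum_lt1 // addrC subrK divff ?gt_eqF.
Qed.

Lemma jretr_jewel : jewel c (jretr x).
Proof.
split; first by split; [exact: jretr_ge0 | exact: jretr_sum].
move=> A A0 cA; have /andP[r1 rn] := core_rank A0 cA.
under eq_bigr do rewrite mxE.
rewrite -mulr_suml ler_pdivlMr //.
have [/existsP[e /andP[eA xe]]|small] := boolP [exists e in A, gap x * eps <= x 0 e].
  rewrite (bigD1 e) //=; apply: ler_wpDr.
    by apply: sumr_ge0 => f _; rewrite addr_ge0 ?low_ge0 ?jretr_excess_ge0.
  apply: ler_wpDr; first exact: jretr_excess_ge0.
  (* Before rescaling, the long edge [e] keeps at least [gap x * eps], which beats [gap x] times the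
     constant of [A] because all constants are below [eps]. *)
  rewrite /low min_r // mulrC ler_pM2l //; apply/ltW/c_lt_eps.
  by rewrite r1.
(* All edges of [A] are short, so before rescaling they keep their lengths, and the required bound
   is the definition of [gap]. *)
rewrite mulrC; apply: le_trans (gap_core x A0 cA) _; apply: ler_sum => e eA.
have xe : x 0 e <= gap x * eps.
  move: small; rewrite negb_exists => /forallP/(_ e); rewrite eA /= -ltNge.
  exact: ltW.
by rewrite /low min_l // lerDl mulr_ge0 ?slope_ge0 // subrr.
Qed.

Lemma jretr_id : jewel c x -> jretr x = x.
Proof.
case/gap_jewel => _ g1; apply/rowP => e; rewrite mxE /slope g1 divff; last first.
  by rewrite gt_eqF ?lowsum_lt1.
by rewrite mul1r divr1 addrC subrK.
Qed.

Lemma jhtpy_id t : jewel c x -> jhtpy t x = x.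
Proof. by move=> xj; rewrite /jhtpy jretr_id // -scalerDl subrK scale1r. Qed.

Lemma jhtpy_gt0 t e : 0 <= t <= 1 -> 0 < x 0 e -> 0 < jhtpy t x 0 e.
Proof.
move=> /andP[t0 t1] xe; have re := jretr_gt0 xe; rewrite jhtpy_jretr.
move: t0; rewrite le_eqVlt => /orP[/eqP <-|t0]; first by rewrite mul0r subr0 addr0 mul1r.
by apply: ltr_wpDl; [rewrite mulr_ge0 ?subr_ge0 | rewrite mulr_gt0].
Qed.

Lemma jhtpy_eq0 t e : x 0 e = 0 -> jhtpy t x 0 e = 0.
Proof.
by move=> xe; rewrite jhtpy_jretr xe jretr_eq0 // !mulr0 addr0.
Qed.

Lemma jhtpy_sum t : \sum_e jhtpy t x 0 e = 1.
Proof.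
under eq_bigr => e _ do rewrite jhtpy_jretr.
by rewrite big_split /= -!mulr_sumr xsum jretr_sum !mulr1 subrK.
Qed.

Lemma jhtpy_zero t : 0 <= t <= 1 -> zero_edges (jhtpy t x) = zero_edges x.
Proof.
move=> t01; apply/setP => e; rewrite !inE; have [xe|xe] := eqVneq (x 0 e) 0.
  by rewrite jhtpy_eq0 // eqxx.
by apply/negbTE; rewrite gt_eqF // jhtpy_gt0 // lt_neqAle eq_sym xe xge.
Qed.

Lemma jhtpy_bar t : 0 <= t <= 1 -> bar_simplex (jhtpy t x).
Proof.
move=> t01; split; last by rewrite jhtpy_zero //; case: xb.
split; last exact: jhtpy_sum.
move=> e; have [xe|xe] := eqVneq (x 0 e) 0; first by rewrite jhtpy_eq0.
by apply/ltW/jhtpy_gt0 => //; rewrite lt_neqAle eq_sym xe xge.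
Qed.

End Point.

Lemma jhtpy_open x t : 0 <= t <= 1 -> open_simplex x -> open_simplex (jhtpy t x).
Proof.
move=> t01 xo; split=> [e|]; last exact/jhtpy_sum/open_bar_simplex.
by apply: jhtpy_gt0 => //; [exact: open_bar_simplex | case: xo].
Qed.

End Graph.

(** * Compatibility of the retraction with collapses *)

Section Naturality.
Variables (G H : graph) (f : gmap G H) (s : edge H -> edge G).
Variables (x : 'rV[R]_(nedge G)) (y : 'rV[R]_(nedge H)).
Hypotheses (rG : forall A : {set edge G}, (rankH1 A <= n)%N).
Hypotheses (rH : forall A : {set edge H}, (rankH1 A <= n)%N).
Hypotheses (fs : collapse (zero_edges x) f s) (yx : forall e, y 0 e = x 0 (s e)).
Hypothesis xb : bar_simplex x.

Let x0 e : e \in zero_edges x -> x 0 e = 0.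
Proof. by rewrite inE => /eqP. Qed.

Let sumE (A : {set edge G}) : \sum_(e in A) x 0 e = \sum_(e in s @^-1: A) y 0 e.
Proof. by rewrite (collapse_sum _ fs x0); apply: eq_bigr => e _; rewrite yx. Qed.

Let yge e : 0 <= y 0 e.
Proof. by rewrite yx; case: xb => -[]. Qed.

Lemma collapse_gap : gap y = gap x.
Proof.
apply/le_anti/andP; split; apply/bigmin_geP; split; try exact: gap_le1.
  (* The image of a core subgraph has the same length and at least the same rank, hence, [c] being
     increasing, at least as large a constant. *)
  move=> A /andP[A0 cA]; have nl := bar_simplex_cycle xb.
  have sA0 := forest_collapse_preim0 fs nl cA A0; have scA := collapse_core fs cA.
  rewrite ler_pdivlMr; last exact/c_gt0/core_rank.
  rewrite sumE; apply: le_trans (gap_core rH y sA0 scA).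
  rewrite ler_wpM2l //.
    apply/bigmin_geP; split=> // B /andP[B0 cB].
    by rewrite divr_ge0 ?sumr_ge0 // ltW // c_gt0 // core_rank.
  have /andP[r1 _] := core_rank rG A0 cA.
  by apply: c_le => //; exact: (forest_collapse_rank fs nl).
move=> C /andP[C0 cC].
(* The preimage of [C] contains the whole collapsed forest and may fail to be core. Its core part
   [B] still carries all its cycles, so its rank is at least that of [C], and its length is at most
   that of [C]. *)
have [B [BA cB zB]] := exists_core (zero_edges x :|: s @: C).
have /andP[r1 rn] := core_rank rH C0 cC.
have rB : (rankH1 C <= rankH1 B)%N.
  apply: leq_trans (collapse_rank_lift fs C) _.
  by apply: (leq_rankH1 (L := 1%:M)) => z; rewrite mulmx1 //; exact: zB.
have B0 : B != finset.set0.
  apply: contraTneq r1 => B0; rewrite -ltnNge ltnS; apply: leq_trans rB _.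
  rewrite B0 rankH1E leqn0 mxrank_eq0; apply/eqP/row_matrixP => i.
  by rewrite row0; apply/cycle_in0/cyclemxP; exact: row_sub.
rewrite ler_pdivlMr; last by rewrite c_gt0 // r1.
apply: (@le_trans _ _ (gap x * c (rankH1 B))).
  apply: ler_wpM2l; first exact/ltW/gap_gt0.
  exact: c_le.
apply: le_trans (gap_core rG x B0 cB) _; rewrite sumE.
have sBC : s @^-1: B \subset C.
  by rewrite -(collapse_preim fs C); exact: preimsetS.
rewrite [leRHS](bigID [in s @^-1: B]) /= ler_wpDr ?sumr_ge0 //.
rewrite le_eqVlt; apply/orP; left; apply/eqP/eq_bigl => e.
by case: (boolP (e \in s @^-1: B)) => [/(fintype.subsetP sBC) ->|]; rewrite ?andbF.
Qed.

Lemma collapse_low e : low y e = low x (s e).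
Proof. by rewrite /low yx collapse_gap. Qed.

Lemma collapse_lowsum : lowsum y = lowsum x.
Proof.
have lx e : e \in zero_edges x -> low x e = 0.
  move=> /x0 xe; rewrite /low xe min_l // mulr_ge0 ?(ltW eps0) //.
  exact/ltW/gap_gt0.
transitivity (\sum_(e in [set: edge G]) low x e).
  rewrite (collapse_sum _ fs lx); apply: eq_big => e; first by rewrite !inE.
  by rewrite collapse_low.
by apply: eq_bigl => e; rewrite inE.
Qed.

Lemma collapse_jhtpy t e : jhtpy t y 0 e = jhtpy t x 0 (s e).
Proof. by rewrite !jhtpyE /slope collapse_low collapse_lowsum collapse_gap yx. Qed.

Lemma collapse_simplex : simplex y.
Proof.
split=> //; have [[_ <-] _] := xb.
transitivity (\sum_(e in [set: edge G]) x 0 e).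
  by rewrite sumE; apply: eq_bigl => e; rewrite !inE.
by apply: eq_bigl => e; rewrite inE.
Qed.

Lemma collapse_jewel : jewel c y <-> jewel c x.
Proof.
rewrite !gap_jewel // collapse_gap; split=> -[_ g1]; split=> //; first by case: xb.
exact: collapse_simplex.
Qed.

End Naturality.

End JewelRetraction.

(** * Continuity of the retraction and compactness of jewels *)

Section Continuity.
Local Open Scope classical_set_scope.
Variables (R : realType) (c : nat -> R) (eps : R) (G : graph).

Lemma cvg_rV (T : Type) (F : set_system T) (FF : Filter F) (k : nat)
    (f : T -> 'rV[R]_k) (l : 'rV[R]_k) :
  (forall e, f x 0 e @[x --> F] --> l 0 e) -> f @ F --> l.
Proof.
move=> fl B [P lP PB].
have H : \forall x \near F, forall e, P 0 e (f x 0 e).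
  by apply: filter_forall => e; exact/fl/lP.
suff : F (f @^-1` B) by [].
by apply: filterS H => x Px; apply: PB => i e; rewrite [i]ord1; exact: Px.
Qed.

Lemma sum_coord_continuous (P : pred (edge G)) :
  continuous (fun x : 'rV[R]_(nedge G) => \sum_(e | P e) x 0 e).
Proof.
apply: (continuous_big (op := +%R)); first exact: add_continuous.
by move=> e _; exact: coord_continuous.
Qed.

Lemma min_cvg (T : Type) (F : set_system T) (FF : Filter F) (f g : T -> R) (a b : R) :
  f @ F --> a -> g @ F --> b -> Num.min (f x) (g x) @[x --> F] --> Num.min a b.
Proof.
move=> fa gb; apply: (continuous2_cvg FF (h := fun u v : R => Num.min u v)) => //.
have -> : (fun z : R * R => Num.min z.1 z.2) = (fst \min snd) by [].
by apply: continuous_min; [exact: cvg_fst | exact: cvg_snd].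
Qed.

Lemma gap_continuous : continuous (gap c (G := G)).
Proof.
apply: (continuous_big (op := Num.min)) => [z|A _ x].
  by apply: min_cvg; [exact: cvg_fst | exact: cvg_snd].
have h := @sum_coord_continuous (fun e => e \in A) x.
exact: (@cvgMr_tmp R _ _ (nbhs_filter x) _ _ _ h).
Qed.

Lemma low_continuous e : continuous (fun x => low c eps (G := G) x e).
Proof.
move=> x; apply: (min_cvg (nbhs_filter x)); first exact: coord_continuous.
exact: (@cvgMr_tmp R _ _ (nbhs_filter x) _ _ _ (@gap_continuous x)).
Qed.

Lemma lowsum_continuous : continuous (lowsum c eps (G := G)).
Proof.
apply: (continuous_big (op := +%R)); first exact: add_continuous.
by move=> e _; exact: low_continuous.
Qed.

Lemma jretr_continuous x : gap c x != 0 -> 1 - lowsum c eps x != 0 ->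
  {for x, continuous (jretr c eps (G := G))}.
Proof.
move=> g0 l0; have FF := nbhs_filter x; apply: (cvg_rV FF) => e; rewrite mxE.
under eq_cvg do rewrite mxE.
have gx := @gap_continuous x; have lx := @low_continuous e x.
have sx := @lowsum_continuous x; have ex := @coord_continuous R _ _ 0 e x.
apply: (cvgM (FF := FF)); last exact: (cvgV (FF := FF) g0 gx).
apply: (cvgD (FF := FF) lx); apply: (cvgM (FF := FF)); last exact: (cvgB (FF := FF) ex lx).
apply: (cvgM (FF := FF) (cvgB (FF := FF) gx sx)).
apply: (cvgV (FF := FF) l0); exact: (cvgB (FF := FF) (cvg_cst _) sx).
Qed.

Lemma jhtpy_continuous (x : 'rV[R]_(nedge G)) (t : R) : gap c x != 0 -> 1 - lowsum c eps x != 0 ->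
  jhtpy c eps (G := G) z.2 z.1 @[z --> (x, t)] --> jhtpy c eps t x.
Proof.
move=> g0 l0; have FF := @nbhs_filter _ (x, t).
have fx : z.1 @[z --> (x, t)] --> x by exact: cvg_fst.
have ft : z.2 @[z --> (x, t)] --> t by exact: cvg_snd.
have rx : jretr c eps (G := G) z.1 @[z --> (x, t)] --> jretr c eps x.
  exact: (cvg_comp _ _ fx (jretr_continuous g0 l0)).
apply: (cvgD (FF := FF)); last exact: (cvgZ (FF := FF) ft rx).
exact: (cvgZ (FF := FF) (cvgB (FF := FF) (cvg_cst _) ft) fx).
Qed.

Lemma jewel_closed : closed (jewel c (G := G)).
Proof.
have cl (P : pred (edge G)) a : closed [set x : 'rV[R]_(nedge G) | a <= \sum_(e | P e) x 0 e].
  refine (preimage_closed (D := [set y | a <= y]) _ (@closed_ge R a)).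
  by move=> x _; exact: sum_coord_continuous.
have cu a : closed [set x : 'rV[R]_(nedge G) | \sum_e x 0 e = a].
  refine (preimage_closed (D := [set y | y = a]) _ (@closed_eq R a)).
  by move=> x _; exact: sum_coord_continuous.
(* A coordinate is written as a sum over one edge, so that [cl] covers both families of
   inequalities. *)
have -> : jewel c (G := G) =
    (\bigcap_(e in [set: edge G]) [set x | 0 <= \sum_(f | f == e) x 0 f]) `&`
    [set x | \sum_e x 0 e = 1] `&`
    (\bigcap_(A in [set A : {set edge G} | (A != finset.set0) && core A])
      [set x | c (rankH1 A) <= \sum_(e in A) x 0 e]).
  apply/seteqP; split=> x.
    move=> [[x0 x1] xj]; split; first split=> // e _ /=; first by rewrite big_pred1_eq.
    by move=> A /andP[A0 cA]; exact: xj.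
  move=> [[x0 x1] xj]; split; first split=> // e; first by have := x0 e I; rewrite /= big_pred1_eq.
  by move=> A A0 cA; apply: xj; rewrite /= A0.
refine (closedI (closedI (closed_bigI _) (@cu 1)) (closed_bigI _)) => // A _; exact: cl.
Qed.

Lemma jewel_compact : compact (jewel c (G := G)).
Proof.
apply: (subclosed_compact jewel_closed (@rV_compact R _ (fun=> `[0, 1]%classic) _)).
  by move=> _; exact: segment_compact.
move=> x [[x0 x1] _] e /=; rewrite in_itv /= x0 -x1 (bigD1 e) //= lerDl.
exact: sumr_ge0.
Qed.

End Continuity.

(** * Outer space *)

Section Flow.
Local Open Scope classical_set_scope.
Variables (R : realType) (n : nat) (c : nat -> R) (eps : R).
Hypotheses (c1 : 0 < c 1%N) (cS : forall r, (1 <= r < n)%N -> c r < c r.+1).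
Hypotheses (eps0 : 0 < eps) (ceps : c n < eps) (epsn : (3 * n.+1)%:R * eps <= 2^-1).
Implicit Types (M : marked n) (X Y : metric_marked R n) (p q : outer_space R n).

Let rM M := @marked_rank n M.
Let eM M := @marked_nedge n M.
Local Notation jh := (jhtpy c eps).

Lemma same_class_jewel X Y : same_class X Y -> jewel c (mlen X) <-> jewel c (mlen Y).
Proof.
move=> [f [s [fs _]]]; have [_ _ _ yx] := fs.
apply: iff_sym; apply: (collapse_jewel c1 cS (@rM X) (@rM Y) _ yx).
  by rewrite (open_simplex_zero (mlenP X)); exact: isometry_collapse fs.
exact: open_bar_simplex (mlenP X).
Qed.

(** A cycle among the edges of length 0 would produce a nonempty core subgraph of length 0, against
    the positivity of the constants. *)
Lemma jewel_bar M (x : 'rV[R]_(nedge M)) : jewel c x -> bar_simplex x.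
Proof.
move=> [xs xj]; split=> // /contains_loopP[z zx z0].
have [B [BA cB /(_ _ zx) zB]] := exists_core (zero_edges x).
have B0 : B != finset.set0.
  by apply: contraNneq z0 => B0; rewrite B0 in zB; rewrite (cycle_in0 zB).
have := xj _ B0 cB; rewrite big1 => [|e /(fintype.subsetP BA)]; last first.
  by rewrite inE => /eqP.
by rewrite leNgt (c_gt0 c1 cS) // core_rank.
Qed.

(** Membership can be tested in any simplex realizing the point: every realization is compared with
    the metric graph of the point itself, as jewels are invariant under collapses and isometries. *)
Lemma jewel_spaceE M (x : 'rV[R]_(nedge M)) p :
  realizes x p -> jewel_space c p <-> jewel c x.
Proof.
have rj M' (x' : 'rV[R]_(nedge M')) q : realizes x' q ->
    exists Y, q = opoint Y /\ (jewel c (mlen Y) <-> jewel c x').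
  move=> [xb [Y [-> [f [s [fs yx _]]]]]]; exists Y; split=> //.
  exact: (collapse_jewel c1 cS (@rM M') (@rM Y) fs yx xb).
move=> xp; split=> [[M' [x' [xj' /rj[Y' [pY' jY']]]]]|xj]; last by exists M, x.
have [Y [pY jY]] := rj _ _ _ xp.
apply/jY/(same_class_jewel (X := Y')); last exact/jY'.
by apply/asboolP/opointP; rewrite -pY'.
Qed.

Lemma jewel_space_opoint X : jewel_space c (opoint X) <-> jewel c (mlen X).
Proof. exact/jewel_spaceE/realizes_self. Qed.

(** A representative is chosen, and [jflowE] removes this choice. For times in [[0, 1]] the first
    branch applies; at other times lengths may cease to be positive, and [z.1] is a default
    value. *)
Definition jflow (z : outer_space R n * R) : outer_space R n :=
  if pselect (open_simplex (jh z.2 (mlen (repr z.1)))) is left xo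
  then opoint (MetricMarked xo) else z.1.

Lemma jhtpy_openM X t : 0 <= t <= 1 -> open_simplex (jh t (mlen X)).
Proof. move=> t01; exact: (jhtpy_open c1 cS eps0 epsn (@rM X) (eM X) t01 (mlenP X)). Qed.

Lemma jflowE X t (t01 : 0 <= t <= 1) :
  jflow (opoint X, t) = opoint (MetricMarked (jhtpy_openM X t01)).
Proof.
rewrite /jflow /=; case: pselect => [xo|]; last by case; exact: jhtpy_openM.
apply/opointP/asboolP; have /asboolP[f [s [fs hf]]] := (opointP _ _).1 (opointK (opoint X)).
exists f, s; split=> //; have [vf bs es yx] := fs; split=> // e.
apply: (collapse_jhtpy c1 cS eps0 (@rM _) (@rM _) _ yx).
  by rewrite (open_simplex_zero (mlenP _)); exact: isometry_collapse fs.
exact: open_bar_simplex (mlenP _).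
Qed.

(** The homotopy does not change which edges have length 0, so the collapse that realizes [p] also
    realizes its image at each time. *)
Lemma realizes_jflow M (x : 'rV[R]_(nedge M)) p t : 0 <= t <= 1 ->
  realizes x p -> realizes (jh t x) (jflow (p, t)).
Proof.
move=> t01 [xb [Y [-> [f [s [fs yx hf]]]]]].
split; first exact: (jhtpy_bar c1 cS eps0 epsn (@rM M) (eM M) xb t01).
rewrite (jflowE Y t01); exists (MetricMarked (jhtpy_openM Y t01)); split=> //.
exists f, s; split=> //.
  by rewrite (jhtpy_zero c1 cS eps0 epsn (@rM M) (eM M) xb t01).
by move=> e; exact: (collapse_jhtpy c1 cS eps0 (@rM _) (@rM _) fs yx xb).
Qed.

Lemma jhtpy_cvg M (x : 'rV[R]_(nedge M)) t : bar_simplex x ->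
  jhtpy c eps (G := M) z.2 z.1 @[z --> (x, t)] --> jh t x.
Proof.
move=> xb; apply: jhtpy_continuous; rewrite gt_eqF //.
  exact: (gap_gt0 c1 cS (@rM M) xb).
exact: (lowsum_lt1 c1 cS eps0 epsn (@rM M) (eM M) xb).
Qed.

(** Open sets are described simplex by simplex in Outer space, but not in its product with the
    interval. So time is handled first: the path of [p] stays in [U] on a compact interval [[a, b]]
    around [t0], and the set [V] of points whose paths do so on [[a, b]] is then shown to be open in
    each simplex. *)
Lemma jflow_continuous : {within setT `*` `[0, 1], continuous jflow}.
Proof.
apply/subspace_continuousP => -[p t0] [_ /=]; rewrite in_itv /= => t001.
move=> B; rewrite nbhsE => -[U [/outer_openE oU Up] UB].
have [a [b [tab ab01 abU]]] : exists a b, [/\ \forall t \near t0, 0 <= t <= 1 -> a <= t <= b,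
    forall t, a <= t <= b -> 0 <= t <= 1 &
    forall t, a <= t <= b -> U (jflow (p, t))].
  rewrite -(opointK p) in Up *; set X := repr p in Up *.
  have xb := open_bar_simplex (mlenP X); have [W [oW UW]] := oU X.
  have xr := realizes_self X.
  have /(jhtpy_cvg (t := t0) xb) [[A D] /= [xA tD] AD] : nbhs (jh t0 (mlen X)) W.
    apply: open_nbhs_nbhs; split=> //.
    by apply/(UW _ _ (realizes_jflow t001 xr)).
  have /nbhs_ballP[d /= d0 dD] := tD.
  (* Half the radius keeps the closed interval inside the open ball; it is cut off at 0 and 1, where
     the flow is controlled. *)
  exists (Num.max 0 (t0 - d / 2)), (Num.min 1 (t0 + d / 2)).
  have in01 t : Num.max 0 (t0 - d / 2) <= t <= Num.min 1 (t0 + d / 2) ->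
      [/\ 0 <= t <= 1, t0 - d / 2 <= t & t <= t0 + d / 2].
    by rewrite ge_max le_min => /andP[/andP[-> ->] /andP[-> ->]].
  split=> [|t /in01[] //|t /in01[t01 t1 t2]]; last first.
    apply/(UW _ _ (realizes_jflow t01 xr)); apply: (AD (mlen X, t)).
    split; first exact: nbhs_singleton.
    by apply: dD; rewrite /ball /= ltr_norml; apply/andP; split; lra.
  have d20 : 0 < d / 2 by lra.
  near=> t => t01.
  have : `|t0 - t| < d / 2 by near: t; exact: nbhsx_ballx.
  rewrite ltr_norml ge_max le_min => /andP[h1 h2]; case/andP: t01 => -> ->.
  by rewrite /=; apply/andP; split; lra.
pose V := [set q | forall t, a <= t <= b -> U (jflow (q, t))].
have oV : nbhs p V.
  apply: open_nbhs_nbhs; split=> //; apply/outer_openE => M; have [W [oW UW]] := oU M.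
  (* The formula for the homotopy is only known to be continuous at points of the simplex with
     missing faces, so the set itself need not be open; those of its points that lie there are
     interior. *)
  exists (interior [set x | forall t, a <= t <= b -> W (jh t x)]).
  split=> [|x q xq]; first exact: open_interior.
  have UWq t : a <= t <= b -> U (jflow (q, t)) <-> W (jh t x).
    by move=> /ab01 t01; apply: UW; exact: realizes_jflow.
  split=> [Vq|/interior_subset Wx t tab']; last exact/(UWq _ tab')/Wx.
  have xb : bar_simplex x by case: xq.
  (* Tube lemma: by compactness of [[a, b]], one neighbourhood of [x] works for all times. *)
  have /compact_near_coveringP/(_ _ (nbhs x) (fun x t => W (jh t x)) _) H :=
    @segment_compact R a b.
  apply: filterS (H _) => [y Wy t tab'|]; first by apply: Wy; rewrite /= in_itv.
  move=> t /=; rewrite in_itv /= => tab'.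
  have /(jhtpy_cvg (t := t) xb)[[A D] /= [xA tD] AD] : nbhs (jh t x) W.
    by apply: open_nbhs_nbhs; split=> //; apply/UWq => //; exact: Vq.
  by exists (D, A) => //= -[t' x'] [/= Dt Ax]; exact: (AD (x', t')).
exists (V, [set t | 0 <= t <= 1 -> a <= t <= b]) => //= -[q t] [/= Vq tq] [_ /=].
by rewrite in_itv /= => /tq/Vq/UB.
Unshelve. all: by end_near. Qed.

End Flow.

(** * Self-equivalences of the rose and changes of marking *)

Section RoseEquivalences.
Variable n : nat.
Local Open Scope group_scope.

Definition rose_hom (u : gmap (rose n) (rose n)) (x : freegrp n) : freegrp n :=
  fword (gw u (repr x)).

Lemma rose_homE u p : rose_hom u (fword p) = fword (gw u p).
Proof. by apply/fwordP/gw_whtpy; exact: repr_fword. Qed.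

Lemma rose_homM u : {morph rose_hom u : x y / x * y}.
Proof.
move=> x y; rewrite -[x]fwordK -[y]fwordK -fwordM !rose_homE gw_cat.
exact: fwordM.
Qed.

(** The track of the vertex under the homotopy is a loop, and its inverse is the conjugating
    element. *)
Lemma rose_hom_conj u v : homotopic (gcomp v u) (gid (rose n)) ->
  exists w, forall x, rose_hom v (rose_hom u x) = x ^ w.
Proof.
move=> [p [_ hp]]; exists (fword (p ord0))^-1 => x.
rewrite -[x]fwordK !rose_homE -gw_gcomp conjgE invgK.
have := homotopic_walk hp (rose_walk ord0 ord0 (repr x)).
by rewrite gw_gid => /fwordP; rewrite !fwordM => /(canRL (mulgK _)); rewrite mulgA.
Qed.

Lemma rose_he_faut u : homotopy_equiv u -> exists f : faut n, homotopic u (rose_map f).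
Proof.
move=> [v [/rose_hom_conj[w vu] /rose_hom_conj[w' uv]]].
have uinj : injective (rose_hom u).
  by move=> x y E; apply: (conjg_inj w); rewrite -!vu E.
(* Undoing the conjugation by [w'] first turns [rose_hom v] into a right inverse of [rose_hom u],
   which is two-sided by injectivity. *)
have vK : cancel (fun x => rose_hom v (x ^ w'^-1)) (rose_hom u).
  by move=> x; rewrite uv conjgKV.
have uK : cancel (rose_hom u) (fun x => rose_hom v (x ^ w'^-1)).
  by move=> x; apply: uinj; rewrite vK.
exists (FAut (@rose_homM u) uK vK); apply: homotopic_eqv => [x|e].
  by rewrite [LHS]ord1 [RHS]ord1.
by apply/fwordP; rewrite /= fwordK rose_homE gw1.
Qed.

(** The composite of [g] with a homotopy inverse of [g0] is a self-equivalence of the rose, hence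
    comes from an automorphism. Thus the automorphisms act transitively on the markings of a
    graph. *)
Lemma marking_change (G : graph) (g g0 : gmap (rose n) G) :
  homotopy_equiv g -> homotopy_equiv g0 ->
  exists f : faut n, homotopic g (gcomp g0 (rose_map f)).
Proof.
move=> hg [h0 [h0g0 g0h0]].
have [|f fE] := @rose_he_faut (gcomp h0 g).
  by apply: homotopy_equiv_comp => //; exists g0.
exists f; apply: homotopic_trans (homotopic_compl g0 fE).
apply: homotopic_trans (gcompA _ _ _); apply: homotopic_sym.
by apply: homotopic_trans (homotopic_compr _ g0h0) _; exact: gcomp1g.
Qed.

End RoseEquivalences.

Lemma same_class_len (R : realType) (n : nat) (M : marked n) (x y : 'rV[R]_(nedge M))
    (xo : open_simplex x) (yo : open_simplex y) : x = y ->
  same_class (MetricMarked xo) (MetricMarked yo).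
Proof.
move=> xy; exists (gid M), id; split; last exact: gcomp1g.
split=> //=; [by exists id | by exists id | by move=> e; exists true | by rewrite xy].
Qed.

(** * Enumerating the graphs of bounded size *)

Section Codes.
Variable N : nat.

(** Since vertices and edges of a [graph] are ordinals, finitely many codes reach every graph of
    bounded size up to equality, not just up to isomorphism. *)
Definition gcode : finType :=
  {v : 'I_N & {e : 'I_N & ({ffun 'I_e -> 'I_v} * {ffun 'I_e -> 'I_v})%type}}.

Definition gdecode (k : gcode) : graph :=
  Graph (tagged (tagged k)).1 (tagged (tagged k)).2.

Lemma gdecode_surj (G : graph) : (nvert G < N)%N -> (nedge G < N)%N ->
  exists k, gdecode k = G.
Proof.
case: G => v e s t /= vN eN.
pose st : ({ffun 'I_(Ordinal eN) -> 'I_(Ordinal vN)} *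
           {ffun 'I_(Ordinal eN) -> 'I_(Ordinal vN)})%type := (finfun s, finfun t).
exists (Tagged (fun v : 'I_N => {e : 'I_N & ({ffun 'I_e -> 'I_v} * {ffun 'I_e -> 'I_v})%type})
  (Tagged (fun e : 'I_N =>
    ({ffun 'I_e -> 'I_(Ordinal vN)} * {ffun 'I_e -> 'I_(Ordinal vN)})%type) st)).
by rewrite /gdecode /=; congr Graph; apply/funext => i; rewrite ffunE.
Qed.

End Codes.

(** * Equivariance and cocompactness *)

Section Action.
Local Open Scope classical_set_scope.
Variables (R : realType) (n : nat) (c : nat -> R) (eps : R).
Hypotheses (c1 : 0 < c 1%N) (cS : forall r, (1 <= r < n)%N -> c r < c r.+1).
Hypotheses (eps0 : 0 < eps) (epsn : (3 * n.+1)%:R * eps <= 2^-1).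
Implicit Types (M : marked n) (p q : outer_space R n).

Lemma jflow_act p o t : 0 <= t <= 1 ->
  jflow c eps (act p o, t) = act (jflow c eps (p, t)) o.
Proof.
move=> t01; rewrite -(opointK p) -(outerK o) actE.
rewrite !(jflowE c1 cS eps0 epsn _ t01) actE.
apply/opointP/asboolP; exists (gid _), id; split; last exact: gcomp1g.
by split=> //; [exists id | exists id | move=> e; exists true].
Qed.

Lemma jewel_space_act p o : jewel_space c p -> jewel_space c (act p o).
Proof.
rewrite -(opointK p) -(outerK o) actE => /(jewel_space_opoint c1 cS) pj.
exact/(jewel_space_opoint c1 cS).
Qed.

Definition realized_jewel M : set (outer_space R n) :=
  [set p | exists x : 'rV[R]_(nedge M), jewel c x /\ realizes x p].

(** This is the image of a compact jewel under a map available only as the relation [realizes],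
    total by [realizable]. Compactness passes through near coverings, because open sets of Outer
    space have open traces on the simplex. *)
Lemma realized_jewel_compact M : compact (realized_jewel M).
Proof.
apply/compact_near_coveringP => I F P FF Pn.
have /compact_near_coveringP/(_ I F (fun i x => forall p, realizes x p -> P i p) FF) H :=
  @jewel_compact R c M.
apply: filterS (H _) => [i Pi p [x [xj xp]]|x xj]; first exact: Pi xj _ xp.
have [p xp] := realizable (jewel_bar c1 cS xj).
have [] := Pn p; first by exists x.
move=> [V B] /= [].
rewrite nbhsE => -[U [/outer_openE oU Up] UV] FB VBP.
have [W [oW UW]] := oU M.
exists (W, B); first by split=> //=; apply: open_nbhs_nbhs; split=> //; exact/(UW _ _ xp).
by move=> [y i] [/= Wy Bi] q yq; apply: (VBP (q, i)); split=> //=; apply/UV/(UW _ _ yq).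
Qed.

(** The two markings differ by an automorphism [f]. With the same coordinates [x], the simplex of
    [M0] realizes the translate of [p] by the inverse of [f]. *)
Lemma realized_jewel_act M0 M p : mgraph M0 = mgraph M -> realized_jewel M p ->
  exists q o, realized_jewel M0 q /\ p = act q o.
Proof.
case: M0 M => G0 o0 g0 h0 [G o g h] /= E; move: o0 g0 h0; rewrite E => {E G0} o0 g0 h0.
have [f gf] := marking_change h h0.
move=> [x [xj [xb [Y [-> [k [s [ks ys kg]]]]]]]].
exists (act (opoint Y) (outer f)^-1%g), (outer f); rewrite -actM mulVg act1; split=> //.
exists x; split=> //; split=> //; exists (mark_change (fautV f) Y); split.
  by rewrite -actE; congr act; exact: oinvE.
exists k, s; split=> //=.
apply: (homotopic_trans _ (homotopic_compr _ kg)).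
apply: (homotopic_trans _ (homotopic_sym (gcompA _ _ _))); apply: homotopic_compl.
apply: (homotopic_trans _ (homotopic_compr _ (homotopic_sym gf))).
apply: (homotopic_trans _ (homotopic_sym (gcompA _ _ _))).
apply: (homotopic_trans (homotopic_sym (gcompg1 _))); apply: homotopic_compl.
apply: homotopic_sym; apply: (homotopic_trans (rose_map_comp f (fautV f))).
apply: (homotopic_trans _ (rose_map1 n)); apply: rose_map_inner; apply/asboolP.
by exists 1%g => y; rewrite conjg1 /= afVK.
Qed.

Lemma jewel_space_cocompact : acts_cocompactly (@act R n) (@jewel_space R n c).
Proof.
split; first by move=> p o; exact: jewel_space_act.
(* One marking is chosen for each graph that admits one; the other graphs contribute the empty
   set. *)
pose KG (G : graph) : set (outer_space R n) :=
  if pselect (exists M : marked n, mgraph M = G) is left h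
  then realized_jewel (projT1 (cid h)) else set0.
(* The outer successor turns the bounds on vertices and edges into the strict ones of
   [gdecode_surj]. *)
pose C := gcode (3 * n.+1).+1.
exists (\big[setU/set0]_(k <- index_enum C) KG (gdecode k)); split.
- apply: bigsetU_compact => k _; rewrite /KG; case: pselect => [h|_].
    exact: realized_jewel_compact.
  exact: compact0.
- rewrite -bigcup_seq => p [k _]; rewrite /KG; case: pselect => // h [x [xj xp]].
  by exists (projT1 (cid h)), x.
move=> p [M [x [xj xp]]].
have [k kM] : exists k : C, gdecode k = mgraph M.
  by apply: gdecode_surj; rewrite ltnS; [exact: marked_nvert | exact: marked_nedge].
have [h hE] : exists h : exists M' : marked n, mgraph M' = mgraph M,
    KG (mgraph M) = realized_jewel (projT1 (cid h)).
  rewrite /KG; case: pselect => [h|]; first by exists h.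
  by case; exists M.
have [] := @realized_jewel_act (projT1 (cid h)) M p.
- exact: projT2 (cid h).
- by exists x.
move=> q [u [qK ->]]; exists q, u; split=> //.
rewrite -bigcup_seq; exists k; first exact: mem_index_enum.
by rewrite kM hE.
Qed.

End Action.

Local Open Scope classical_set_scope.
Local Open Scope ring_scope.

Theorem mainTheorem1 (R : realType) (n : nat) (hn : (2 <= n)%N) :
  exists eps : R, 0 < eps /\
  forall c : nat -> R,
    0 < c 1%N ->
    (forall r : nat, (1 <= r < n)%N -> c r < c r.+1 /\ 2 * c r < c r.+1) ->
    c n < eps ->
    [/\ closed (@jewel_space R n c),
        equivariant_deformation_retract R (@act R n) (@jewel_space R n c) &
        acts_cocompactly (@act R n) (@jewel_space R n c)].
Proof.
have N0 : 0 < (3 * n.+1)%:R :> R by rewrite ltr0n.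
(* A marked graph has at most [3 n + 3] edges, so with this threshold its short parts add up to at
   most half of [gap]. *)
pose eps : R := 2^-1 / (3 * n.+1)%:R.
have eps0 : 0 < eps by rewrite divr_gt0 // invr_gt0.
have epsn : (3 * n.+1)%:R * eps <= 2^-1 by rewrite mulrC mulfVK // gt_eqF.
exists eps; split=> // c c1 cS2 ceps.
have cS r : (1 <= r < n)%N -> c r < c r.+1 by case/cS2.
split.
- rewrite -openC; apply/outer_openE => M.
  exists (~` jewel c (G := M))%classic; split.
    by rewrite openC; exact: jewel_closed.
  by move=> x p xp; split; apply: contra_not => /(jewel_spaceE c1 cS xp).
- exists (jflow c eps); split.
  + exact: jflow_continuous.
  + move=> p; have t01 : 0 <= (0 : R) <= 1 by rewrite lexx ler01.
    rewrite -(opointK p) (jflowE c1 cS eps0 epsn _ t01); case: (repr p) => M x xo.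
    by apply/opointP/asboolP/same_class_len; exact: jhtpy0.
  + move=> p; have t01 : 0 <= (1 : R) <= 1 by rewrite lexx ler01.
    rewrite -(opointK p) (jflowE c1 cS eps0 epsn _ t01).
    apply/(jewel_space_opoint c1 cS); rewrite /= jhtpy1.
    apply: (jretr_jewel c1 cS eps0 ceps epsn); last exact/open_bar_simplex/mlenP.
      by move=> A; exact: marked_rank.
    exact: marked_nedge.
  + move=> p t; rewrite -(opointK p) => /(jewel_space_opoint c1 cS) pj t01.
    rewrite (jflowE c1 cS eps0 epsn _ t01); case: (repr p) pj => M x xo /= pj.
    apply/opointP/asboolP/same_class_len; apply: (jhtpy_id c1 cS eps0 epsn) pj.
    * by move=> A; exact: marked_rank.
    * exact: marked_nedge.
    * exact: open_bar_simplex.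
  + by move=> p t o t01; exact: (jflow_act c1 cS eps0 epsn).
- exact: jewel_space_cocompact.
Qed.
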